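(* Let $X$ be a smooth projective variety over $\mathbb{C}$, $n\geq 1$ and $r\geq 1$ integers, $X_n$ a primitive multiple scheme of multiplicity $n$ with $(X_n)_{red}=X$ which is the canonical subscheme of multiplicity $n$ of a primitive multiple scheme $X_{n+1}$ of multiplicity $n+1$, and $L$ the associated line bundle on $X$. Let $g\in H^1(X_n,\mathrm{GL}(r,\mathcal{O}_{X_n}))$, $\mathbb{E}$ the corresponding rank $r$ vector bundle on $X_n$, and $E=\mathbb{E}_{|X}$. Then the twisted sheaf $M(r,L^n)^g$ associated to the exact sequence $$0\to M(r,L^n)\to\mathrm{GL}(r,\mathcal{O}_{X_{n+1}})\to\mathrm{GL}(r,\mathcal{O}_{X_n})\to 0$$ satisfies $M(r,L^n)^g\simeq E^*\otimes E\otimes L^n$.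
   Context: A primitive multiple scheme with support $X$ ($X$ smooth connected of dimension $d$) is a Cohen-Macaulay scheme $Y$ over $\mathbb{C}$ with $Y_{red}=X$ such that every closed point of $X$ has a neighbourhood in $Y$ which is a locally closed subscheme of a smooth variety of dimension $d+1$. Its multiplicity is the smallest $m$ with $\mathcal{I}_X^m=0$, $\mathcal{I}_X$ being the ideal sheaf of $X$ in $Y$; for $1\leq i\leq m$ the canonical subscheme of multiplicity $i$ is the closed subscheme with ideal $\mathcal{I}_X^i$. If $Y=X_{n+1}$ has multiplicity $n+1$, the associated line bundle is $L=\mathcal{I}_X/\mathcal{I}_X^2$, and $\mathcal{I}_X^n\simeq L^n$. $\mathrm{GL}(r,\mathcal{O}_{X_p})$ is the sheaf of groups of invertible $r\times r$ matrices with coefficients in $\mathcal{O}_{X_p}$ (with multiplication), seen as a sheaf of groups on the common underlying topological space, and $M(r,\mathcal{E})$ is the sheaf of groups of $r\times r$ matrices with coefficients in a coherent sheaf $\mathcal{E}$ (with addition). The kernel of $\mathrm{GL}(r,\mathcal{O}_{X_{n+1}})\to\mathrm{GL}(r,\mathcal{O}_{X_n})$ is $I+M(r,\mathcal{I}_X^n)\simeq M(r,L^n)$. Conjugation in $\mathrm{GL}(r,\mathcal{O}_{X_{n+1}})$ induces an action of $\mathrm{GL}(r,\mathcal{O}_{X_n})$ on $M(r,L^n)$. If $g$ is represented by a cocycle $(\theta_{ij})$ for an open cover $(U_i)$, $M(r,L^n)^g$ is obtained by gluing the sheaves $M(r,L^n)_{|U_i}$ by means of the automorphisms of $M(r,L^n)_{|U_{ij}}$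 defined by the action of $\theta_{ij}$: its sections are families $(\gamma_i)$ with $\gamma_i=\theta_{ij}\gamma_j\theta_{ij}^{-1}$. *)

(* Defs.v *)
(* The notations of multinomials clash with those of MathComp-Analysis, hence
   the filtered import. The field of complex numbers is R[i], R : realType. *)
From HB Require Import structures.
From mathcomp Require Import all_boot all_order all_algebra complex.
From mathcomp Require Import boolp classical_sets reals topology.
From mathcomp Require mpoly.
Import (canonicals, coercions) mpoly.

Set Implicit Arguments.
Unset Strict Implicit.
Unset Printing Implicit Defensive.

Import GRing.Theory.
Local Open Scope classical_set_scope.
Local Open Scope ring_scope.

(** * Open subsets *)

(* Primitive, so that an open set is convertible to [Opens] of its projections;
   composition of comorphisms below relies on it. *)
#[local] Set Primitive Projections.
Record opens (T : topologicalType) := Opens {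
  oset :> set T;
  oset_open : open oset
}.
#[local] Unset Primitive Projections.

Definition otop (T : topologicalType) : opens T := Opens (@openT T).

Definition ocap (T : topologicalType) (U V : opens T) : opens T :=
  Opens (openI (oset_open U) (oset_open V)).

Lemma sub_otop (T : topologicalType) (U : opens T) : U `<=` otop T.
Proof. by []. Qed.

Definition opreim (S T : topologicalType) (f : S -> T)
    (f_cont : forall V : set T, open V -> open (f @^-1` V)) (V : opens T) :
  opens S := Opens (f_cont V (oset_open V)).

(** * Commutative algebra *)

(* Rings are [comPzRingType]s: the zero ring is allowed, as it is the ring of
   sections over the empty set. *)

Definition invertible (A : comPzRingType) (a : A) : Prop :=
  exists b, a * b = 1.

Definition inverses_mx (A : comPzRingType) (r : nat) (g h : 'M[A]_r) : Prop :=
  g *m h = 1%:M /\ h *m g = 1%:M.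

Definition in_GL (A : comPzRingType) (r : nat) (g : 'M[A]_r) : Prop :=
  exists h, inverses_mx g h.

Definition ideal_gen (A : comPzRingType) (k : nat) (f : 'I_k -> A) : set A :=
  [set a | exists c : 'I_k -> A, a = \sum_(i < k) c i * f i].

Definition prime_ideal (A : comPzRingType) (p : set A) : Prop :=
  [/\ p 0, (forall a b, p a -> p b -> p (a + b)),
      (forall a b, p b -> p (a * b)), ~ p 1 &
      (forall a b, p (a * b) -> p a \/ p b)].

Definition is_localization (A B : comPzRingType) (f : A)
    (rho : {rmorphism A -> B}) : Prop :=
  [/\ invertible (rho f),
      (forall b, exists a k, b * rho f ^+ k = rho a) &
      (forall a, rho a = 0 -> exists k, f ^+ k * a = 0)].

Definition is_greatest_nat (P : nat -> Prop) (k : nat) : Prop :=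
  P k /\ forall j, P j -> (j <= k)%N.

Definition prime_chain (A : comPzRingType) (k : nat) : Prop :=
  exists p : nat -> set A,
    (forall i, (i <= k)%N -> prime_ideal (p i)) /\
    (forall i, (i < k)%N -> p i `<` p i.+1).

Definition krull_dim (A : comPzRingType) (k : nat) : Prop :=
  is_greatest_nat (prime_chain A) k.

(* For a local ring: the maximal ideal is the set of non-invertible elements. *)
Definition has_regular_sequence (A : comPzRingType) (k : nat) : Prop :=
  exists f : nat -> A,
    (forall i, (i < k)%N -> ~ invertible (f i)) /\
    (forall i, (i < k)%N -> forall a,
       ideal_gen (fun j : 'I_i => f j) (f i * a) ->
       ideal_gen (fun j : 'I_i => f j) a).

Definition local_depth (A : comPzRingType) (k : nat) : Prop :=
  is_greatest_nat (@has_regular_sequence A) k.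

Definition local_CM (A : comPzRingType) : Prop :=
  exists k, local_depth A k /\ krull_dim A k.

(* [mpoly.mmap] is restricted to nonzero rings. *)
Definition aeval (A : comNzRingType) (B : comPzRingType) (s : A -> B)
    (k : nat) (t : 'I_k -> B) (f : mpoly.mpoly k A) : B :=
  \sum_(m <- mpoly.msupp f) s (mpoly.mcoeff m f) * \prod_(i < k) t i ^+ m i.

(** * Sheaves of rings *)

Definition sheaf_axiom (T : topologicalType) (F : opens T -> Type)
    (res : forall U V : opens T, V `<=` U -> F U -> F V) : Prop :=
  forall (I : Type) (V : I -> opens T) (U : opens T)
         (sVU : forall i, V i `<=` U),
    (forall x, oset U x -> exists i, oset (V i) x) ->
    forall s : forall i, F (V i),
      (forall i j (W : opens T) (hi : W `<=` V i) (hj : W `<=` V j),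
         res _ _ hi (s i) = res _ _ hj (s j)) ->
      exists! t : F U, forall i, res _ _ (sVU i) t = s i.

Record ring_sheaf (T : topologicalType) := RingSheaf {
  sec :> opens T -> comPzRingType;
  rs : forall U V : opens T, V `<=` U -> {rmorphism sec U -> sec V};
  rs_id : forall (U : opens T) (h : U `<=` U) (s : sec U), rs h s = s;
  rs_comp : forall (U V W : opens T) (h : V `<=` U) (k : W `<=` V) (l : W `<=` U)
              (s : sec U), rs k (rs h s) = rs l s;
  rs_sheaf : sheaf_axiom (fun U V (h : V `<=` U) => rs h : sec U -> sec V)
}.
Arguments rs {T} O {U V} h : rename.

Definition invertible_near (T : topologicalType) (O : ring_sheaf T)
    (U : opens T) (s : O U) (x : T) : Prop :=
  exists (V : opens T) (h : V `<=` U), oset V x /\ invertible (rs O h s).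

(* Sheaves of algebras over the complex numbers, given by the sheaf of rings
   and the scalars as global sections. *)
Record alg_sheaf (R : realType) (T : topologicalType) := AlgSheaf {
  ringsh :> ring_sheaf T;
  scal_top : {rmorphism R[i] -> ringsh (otop T)}
}.

Definition scal (R : realType) (T : topologicalType) (O : alg_sheaf R T)
    (U : opens T) (c : R[i]) : O U := rs O (@sub_otop T U) (scal_top O c).
Arguments scal {R T} O U c.

Definition aev (R : realType) (T : topologicalType) (O : alg_sheaf R T)
    (U : opens T) (k : nat) (t : 'I_k -> O U) (f : mpoly.mpoly k R[i]) : O U :=
  aeval (scal O U) t f.

Record alg_hom (R : realType) (T : topologicalType) (O O' : alg_sheaf R T) :=
  AlgHom {
  ah :> forall U : opens T, {rmorphism O U -> O' U};
  ah_rs : forall (U V : opens T) (h : V `<=` U) (s : O U),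
    ah V (rs O h s) = rs O' h (ah U s);
  ah_scal : forall U c, ah U (scal O U c) = scal O' U c
}.

Definition alg_comp (R : realType) (T : topologicalType)
    (O O' O'' : alg_sheaf R T) (p : alg_hom O' O'') (q : alg_hom O O') :
  alg_hom O O''.
Proof.
refine (@AlgHom R T O O'' (fun U => (p U \o q U : {rmorphism _ -> _})) _ _).
- by move=> U V h s; rewrite /= !ah_rs.
- by move=> U c; rewrite /= !ah_scal.
Defined.

(** * Schemes over the complex numbers *)

Record cspace (R : realType) := CSpace {
  pts :> topologicalType;
  osh : alg_sheaf R pts
}.

(* The open subset U is isomorphic, as a ringed space, to the spectrum of
   A = O(U): [pr] identifies its points with the primes of A, the subsets D(f)
   form a basis of the topology, and O(D(f)) is the localization of A at f. *)
Definition affine_open (T : topologicalType) (O : ring_sheaf T)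
    (U : opens T) : Prop :=
  exists pr : T -> set (O U),
  let D (f : O U) := [set x | oset U x /\ ~ pr x f] in
  [/\ (forall x, oset U x -> prime_ideal (pr x)) /\
      (forall p, prime_ideal p -> exists2 x, oset U x & pr x = p),
      (forall x y, oset U x -> oset U y -> pr x = pr y -> x = y),
      (forall f, open (D f)),
      (forall (V : opens T) x, V `<=` U -> oset V x ->
         exists2 f, D f x & D f `<=` V) &
      (forall f (V : opens T) (h : V `<=` U), oset V = D f ->
         is_localization f (rs O h))].

Definition is_scheme (R : realType) (X : cspace R) : Prop :=
  forall x : X, exists2 U : opens X, oset U x & affine_open (osh X) U.

Record cmorph (R : realType) (X Y : cspace R) := CMorph {
  cfun :> X -> Y;
  ccont : forall V : set Y, open V -> open (cfun @^-1` V);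
  com : forall V : opens Y, {rmorphism osh Y V -> osh X (opreim ccont V)};
  com_rs : forall (V W : opens Y) (h : W `<=` V)
             (k : opreim ccont W `<=` opreim ccont V) (s : osh Y V),
    com W (rs (osh Y) h s) = rs (osh X) k (com V s);
  com_scal : forall V c, com V (scal (osh Y) V c) = scal (osh X) _ c;
  com_local : forall (V : opens Y) (s : osh Y V) (x : X), oset V (cfun x) ->
    invertible_near (com V s) x -> invertible_near s (cfun x)
}.

Definition cmorph_eq (R : realType) (X Y : cspace R) (f g : cmorph X Y) :
  Prop :=
  (forall x, f x = g x) /\
  (forall (V : opens Y) (s : osh Y V) (W : opens X)
      (h : W `<=` opreim (ccont f) V) (k : W `<=` opreim (ccont g) V),
    rs (osh X) h (com f V s) = rs (osh X) k (com g V s)).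

Definition cmorph_id (R : realType) (X : cspace R) : cmorph X X.
Proof.
refine (@CMorph R X X idfun (fun _ oV => oV)
          (fun V => (idfun : {rmorphism osh X V -> osh X V})) _ _ _) => //=.
by move=> V W h k s; congr (rs _ _ _); exact: Prop_irrelevance.
Defined.

Definition cmorph_comp (R : realType) (X Y Z : cspace R)
  (g : cmorph Y Z) (f : cmorph X Y) : cmorph X Z.
Proof.
refine (@CMorph R X Z (fun x => g (f x))
          (fun V oV => ccont f (ccont g oV))
          (fun V => (com f (opreim (ccont g) V) \o com g V
                     : {rmorphism _ -> _})) _ _ _) => /=.
- move=> V W h k s.
  have k' : opreim (ccont g) W `<=` opreim (ccont g) V by move=> y; exact: h.
  by rewrite (com_rs h k') (com_rs k' k).
- by move=> V c; rewrite !com_scal.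
- move=> V s x Vx sx; apply: (com_local (c0 := g)) => //.
  exact: (com_local (c0 := f) (V := opreim (ccont g) V)).
Defined.

Definition open_immersion (R : realType) (W Y : cspace R) (j : cmorph W Y) :
  Prop :=
  [/\ open (range j),
      injective j,
      (forall U : set W, open U -> open (j @` U)) &
      (forall V : opens Y, V `<=` range j -> bijective (com j V))].

(* A topological embedding such that the maps of stalks
   O_{Y, f x} -> O_{X, x} are surjective. *)
Definition embedding_surj (R : realType) (X Y : cspace R) (f : cmorph X Y) :
  Prop :=
  [/\ injective f,
      (forall U : opens X, exists V : opens Y, oset U = f @^-1` V) &
      (forall (U : opens X) (s : osh X U) (x : X), oset U x ->
         exists (V : opens Y) (t : osh Y V) (W : opens X) (h : W `<=` U)
                (k : W `<=` opreim (ccont f) V),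
           oset W x /\ rs (osh X) h s = rs (osh X) k (com f V t))].

Definition closed_immersion (R : realType) (X Y : cspace R) (f : cmorph X Y) :
  Prop := closed (range f) /\ embedding_surj f.

Definition locally_closed_immersion (R : realType) (X Y : cspace R)
    (f : cmorph X Y) : Prop :=
  (exists A B : set Y, [/\ closed A, open B & range f = A `&` B]) /\
  embedding_surj f.

Definition is_self_product (R : realType) (Z P : cspace R)
    (p1 p2 : cmorph P Z) : Prop :=
  is_scheme P /\
  forall (W : cspace R) (f g : cmorph W Z), is_scheme W ->
    (exists h : cmorph W P,
       cmorph_eq (cmorph_comp p1 h) f /\ cmorph_eq (cmorph_comp p2 h) g) /\
    (forall h h' : cmorph W P,
       cmorph_eq (cmorph_comp p1 h) (cmorph_comp p1 h') ->
       cmorph_eq (cmorph_comp p2 h) (cmorph_comp p2 h') -> cmorph_eq h h').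

Definition separated (R : realType) (Z : cspace R) : Prop :=
  exists (P : cspace R) (p1 p2 : cmorph P Z) (diag : cmorph Z P),
    [/\ is_self_product p1 p2,
        cmorph_eq (cmorph_comp p1 diag) (cmorph_id Z),
        cmorph_eq (cmorph_comp p2 diag) (cmorph_id Z) &
        closed_immersion diag].

Definition finite_type (R : realType) (Z : cspace R) : Prop :=
  compact [set: Z] /\
  forall x : Z, exists U : opens Z,
    [/\ oset U x, affine_open (osh Z) U &
        exists k (t : 'I_k -> osh Z U), forall a, exists f, aev t f = a].

Definition integral (R : realType) (Z : cspace R) : Prop :=
  (exists x : Z, True) /\
  forall U : opens Z, U !=set0 ->
    (1 : osh Z U) <> 0 /\
    forall a b : osh Z U, a * b = 0 -> a = 0 \/ b = 0.

Definition is_variety (R : realType) (Z : cspace R) : Prop :=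
  [/\ is_scheme Z, separated Z, finite_type Z & integral Z].

(* Smoothness of relative dimension d over the complex numbers: locally
   C[x_1, ..., x_(c+d)]/(f_1, ..., f_c), with the Jacobian determinant
   of f_1, ..., f_c with respect to x_1, ..., x_c invertible. *)
Definition smooth_of_dim (R : realType) (d : nat) (Z : cspace R) : Prop :=
  forall x : Z, exists U : opens Z,
    [/\ oset U x, affine_open (osh Z) U &
      exists (c : nat) (t : 'I_(c + d) -> osh Z U)
             (f : 'I_c -> mpoly.mpoly (c + d) R[i]),
      [/\ (forall a, exists g, aev t g = a),
          (forall g, aev t g = 0 <-> ideal_gen f g) &
          invertible (\det (\matrix_(i, j)
            aev t (mpoly.mderiv (lshift d j) (f i))))]].

Definition smooth_variety (R : realType) (d : nat) (Z : cspace R) : Prop :=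
  is_variety Z /\ smooth_of_dim d Z.

(* Projective space through its standard charts: [t i j] is the function
   x_j/x_i on the chart [D i] where x_i does not vanish, so that
   O(D i) = C[x_0, ..., x_N]/(x_i - 1). *)
Definition is_projective_space (R : realType) (N : nat) (Z : cspace R) :
  Prop :=
  is_scheme Z /\
  exists (D : 'I_N.+1 -> opens Z) (t : forall i, 'I_N.+1 -> osh Z (D i)),
    [/\ (forall x, exists i, oset (D i) x) /\
        (forall i, affine_open (osh Z) (D i)),
        (forall i a, exists g, aev (t i) g = a),
        (forall i g, aev (t i) g = 0 <->
           exists h, g = h * (mpoly.mpolyX R[i] (mpoly.mnm1 i) - 1)),
        (forall i j x, oset (D i) x ->
           (oset (D j) x <-> invertible_near (t i j) x)) &
        (forall i j k (W : opens Z) (hi : W `<=` D i) (hj : W `<=` D j),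
           rs (osh Z) hi (t i j) * rs (osh Z) hj (t j k) =
           rs (osh Z) hi (t i k))].

Definition projective (R : realType) (X : cspace R) : Prop :=
  exists (N : nat) (P : cspace R) (f : cmorph X P),
    is_projective_space N P /\ closed_immersion f.

(* B, with the maps [germ], is the stalk of O at x. *)
Definition is_stalk (T : topologicalType) (O : ring_sheaf T) (x : T)
    (B : comPzRingType)
    (germ : forall U : opens T, oset U x -> {rmorphism O U -> B}) : Prop :=
  [/\ (forall (U V : opens T) (h : V `<=` U) (Ux : oset U x) (Vx : oset V x)
         (s : O U), germ V Vx (rs O h s) = germ U Ux s),
      (forall b, exists (U : opens T) (Ux : oset U x) (s : O U),
         germ U Ux s = b) &
      (forall (U : opens T) (Ux : oset U x) (s : O U), germ U Ux s = 0 ->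
         exists (V : opens T) (h : V `<=` U), oset V x /\ rs O h s = 0)].

Definition cohen_macaulay (T : topologicalType) (O : ring_sheaf T) : Prop :=
  forall x : T, exists (B : comPzRingType)
    (germ : forall U : opens T, oset U x -> {rmorphism O U -> B}),
    is_stalk germ /\ local_CM B.

(** * Primitive multiple schemes *)

Definition locally_surjective (R : realType) (T : topologicalType)
    (O O' : alg_sheaf R T) (q : alg_hom O O') : Prop :=
  forall (U : opens T) (s : O' U) (x : T), oset U x ->
    exists (V : opens T) (h : V `<=` U) (t : O V),
      oset V x /\ q V t = rs O' h s.

Definition ker (R : realType) (T : topologicalType) (O O' : alg_sheaf R T)
    (q : alg_hom O O') (U : opens T) : set (O U) := [set a | q U a = 0].
Arguments ker {R T O O'} q U.

(* Sections of the m-th power of the ideal sheaf [ker q]: locally, linear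
   combinations of products of m sections of [ker q]. *)
Definition ker_pow (R : realType) (T : topologicalType) (O O' : alg_sheaf R T)
    (q : alg_hom O O') (m : nat) (U : opens T) : set (O U) :=
  [set a | forall x, oset U x ->
     exists (V : opens T) (h : V `<=` U) (k : nat) (c : 'I_k -> O V)
            (b : 'I_k -> 'I_m -> O V),
       [/\ oset V x, (forall j i, ker q V (b j i)) &
           rs O h a = \sum_(j < k) c j * \prod_(i < m) b j i]].
Arguments ker_pow {R T O O'} q m U.

(* (T, O') is the closed subscheme of (T, O) defined by the nilradical. *)
Definition is_reduction (R : realType) (T : topologicalType)
    (O O' : alg_sheaf R T) (q : alg_hom O O') : Prop :=
  locally_surjective q /\
  forall (U : opens T) (a : O U), ker q U a <->
    forall x, oset U x -> exists (V : opens T) (h : V `<=` U) (k : nat),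
      oset V x /\ rs O h a ^+ k = 0.

Definition has_multiplicity (R : realType) (T : topologicalType)
    (O O' : alg_sheaf R T) (q : alg_hom O O') (m : nat) : Prop :=
  let pow_zero k := forall U a, ker_pow q k U a -> a = 0 in
  pow_zero m /\ forall k, pow_zero k -> (m <= k)%N.

(* The scheme Y = (T, OY) is primitive of multiplicity m, with support
   Y_red = X = (T, OX), the inclusion of X in Y being given by [q]. *)
Definition primitive_multiple_scheme (R : realType) (T : topologicalType)
    (d : nat) (OX OY : alg_sheaf R T) (q : alg_hom OY OX) (m : nat) : Prop :=
  let Y := CSpace OY in
  [/\ is_scheme Y, cohen_macaulay OY, is_reduction q,
      (forall x : T, closed [set x] ->
         exists (W Z : cspace R) (j : cmorph W Y) (f : cmorph W Z),
           [/\ is_scheme W, open_immersion j, range j x,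
               smooth_variety d.+1 Z & locally_closed_immersion f]) &
      has_multiplicity q m].

(* [p] is the inclusion in Y of its canonical subscheme of multiplicity m,
   [q] being the inclusion in Y of its support. *)
Definition canonical_subscheme (R : realType) (T : topologicalType)
    (OX OY OYm : alg_sheaf R T) (q : alg_hom OY OX) (p : alg_hom OY OYm)
    (m : nat) : Prop :=
  locally_surjective p /\
  forall U a, ker p U a <-> ker_pow q m U a.

(** * Sheaves of modules *)

Record mod_sheaf (T : topologicalType) (O : ring_sheaf T) := ModSheaf {
  msec :> forall U : opens T, lmodType (O U);
  mrs : forall U V : opens T, V `<=` U -> {additive msec U -> msec V};
  mrs_scale : forall (U V : opens T) (h : V `<=` U) (a : O U) (m : msec U),
    mrs h (a *: m) = rs O h a *: mrs h m;
  mrs_id : forall (U : opens T) (h : U `<=` U) (m : msec U), mrs h m = m;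
  mrs_comp : forall (U V W : opens T) (h : V `<=` U) (k : W `<=` V) (l : W `<=` U)
               (m : msec U), mrs k (mrs h m) = mrs l m;
  mrs_sheaf : sheaf_axiom (fun U V (h : V `<=` U) => mrs h : msec U -> msec V)
}.
Arguments mrs {T O} M {U V} h : rename.

Definition struct_mod (T : topologicalType) (O : ring_sheaf T) : mod_sheaf O.
Proof.
refine (@ModSheaf T O (fun U => (O U)^o)
          (fun U V h => (rs O h : {additive _ -> _})) _ _ _ _).
- by move=> U V h a m; rewrite /GRing.scale /= rmorphM.
- by move=> U h m; exact: rs_id.
- by move=> U V W h k l m; exact: rs_comp.
- exact: rs_sheaf.
Defined.

Record mod_hom (T : topologicalType) (O : ring_sheaf T) (F G : mod_sheaf O) :=
  ModHom {
  mh :> forall U : opens T, {linear F U -> G U};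
  mh_rs : forall (U V : opens T) (h : V `<=` U) (m : F U),
    mh V (mrs F h m) = mrs G h (mh U m)
}.

Definition mod_iso (T : topologicalType) (O : ring_sheaf T)
    (F G : mod_sheaf O) : Prop :=
  exists f : mod_hom F G, forall U, bijective (f U).

Record bilinear_map (T : topologicalType) (O : ring_sheaf T)
    (F G H : mod_sheaf O) := BilinearMap {
  bl :> forall U : opens T, F U -> G U -> H U;
  bl_linl : forall U a (x x' : F U) (y : G U),
    bl (a *: x + x') y = a *: bl x y + bl x' y;
  bl_linr : forall U a (x : F U) (y y' : G U),
    bl x (a *: y + y') = a *: bl x y + bl x y';
  bl_rs : forall (U V : opens T) (h : V `<=` U) (x : F U) (y : G U),
    bl (mrs F h x) (mrs G h y) = mrs H h (bl x y)
}.

(* H, with [b], is the tensor product of F and G over O. *)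
Definition is_tensor (T : topologicalType) (O : ring_sheaf T)
    (F G H : mod_sheaf O) (b : bilinear_map F G H) : Prop :=
  forall (K : mod_sheaf O) (c : bilinear_map F G K),
    (exists f : mod_hom H K, forall U x y, f U (b U x y) = c U x y) /\
    (forall f g : mod_hom H K,
       (forall U x y, f U (b U x y) = g U (b U x y)) ->
       forall U z, f U z = g U z).

Definition tensor_product (T : topologicalType) (O : ring_sheaf T)
    (F G H : mod_sheaf O) : Prop :=
  exists b : bilinear_map F G H, is_tensor b.

Fixpoint tensor_power (T : topologicalType) (O : ring_sheaf T)
    (L : mod_sheaf O) (n : nat) (H : mod_sheaf O) : Prop :=
  match n with
  | 0 => mod_iso (struct_mod O) H
  | n'.+1 => exists2 K, tensor_power L n' K & tensor_product K L H
  end.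

(* D is the sheaf Hom(F, O): through the evaluation [ev], its sections over U
   are the morphisms of sheaves F|U -> O|U. *)
Definition is_dual (T : topologicalType) (O : ring_sheaf T)
    (F D : mod_sheaf O) : Prop :=
  exists ev : bilinear_map D F (struct_mod O),
  forall (U : opens T) (f : forall V : opens T, V `<=` U -> F V -> O V),
    (forall (V : opens T) (h : V `<=` U) a x y, f V h (a *: x + y) = a * f V h x + f V h y) ->
    (forall (V W : opens T) (h : V `<=` U) (k : W `<=` V) (l : W `<=` U) x,
       f W l (mrs F k x) = rs O k (f V h x)) ->
    exists! D0 : D U, forall (V : opens T) (h : V `<=` U) x, ev V (mrs D h D0) x = f V h x.

(* F' = F/(ker q)F is the restriction of F to the closed subscheme (T, O') of
   (T, O). *)
Definition is_restriction (R : realType) (T : topologicalType)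
    (O O' : alg_sheaf R T) (q : alg_hom O O')
    (F : mod_sheaf O) (F' : mod_sheaf O') : Prop :=
  exists rho : forall U : opens T, {additive F U -> F' U},
    [/\ (forall U a x, rho U (a *: x) = q U a *: rho U x),
        (forall (U V : opens T) (h : V `<=` U) x,
           rho V (mrs F h x) = mrs F' h (rho U x)),
        (forall (U : opens T) (y : F' U) t, oset U t ->
           exists (V : opens T) (h : V `<=` U) (x : F V),
             oset V t /\ rho V x = mrs F' h y) &
        (forall U x, rho U x = 0 <-> forall t, oset U t ->
           exists (V : opens T) (h : V `<=` U) (k : nat)
                  (a : 'I_k -> O V) (y : 'I_k -> F V),
             [/\ oset V t, (forall j, ker q V (a j)) &
                 mrs F h x = \sum_(j < k) a j *: y j])].

(* L is the sheaf I/I^2 on (T, O'), where I = [ker q]. Only the values of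
   [lam] on sections of I are constrained. *)
Definition is_conormal (R : realType) (T : topologicalType)
    (O O' : alg_sheaf R T) (q : alg_hom O O') (L : mod_sheaf O') : Prop :=
  exists lam : forall U : opens T, O U -> L U,
    [/\ (forall U a b, ker q U a -> ker q U b ->
           lam U (a + b) = lam U a + lam U b) /\
        (forall U f a, ker q U a -> lam U (f * a) = q U f *: lam U a),
        (forall (U V : opens T) (h : V `<=` U) a, ker q U a ->
           lam V (rs O h a) = mrs L h (lam U a)),
        (forall (U : opens T) (l : L U) t, oset U t ->
           exists (V : opens T) (h : V `<=` U) (a : O V),
             [/\ oset V t, ker q V a & lam V a = mrs L h l]) &
        (forall U a, ker q U a -> (lam U a = 0 <-> ker_pow q 2 U a))].

(* An isomorphism of sheaves of O'-modules from N onto the ideal sheaf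
   (ker q)^m of O; this ideal is an O'-module when (ker q)^(m+1) = 0. *)
Record ideal_pow_iso (R : realType) (T : topologicalType)
    (O O' : alg_sheaf R T) (q : alg_hom O O') (m : nat) (N : mod_sheaf O') :=
  IdealPowIso {
  ipi :> forall U : opens T, {additive N U -> O U};
  ipi_scale : forall U (f : O U) l, ipi U (q U f *: l) = f * ipi U l;
  ipi_rs : forall (U V : opens T) (h : V `<=` U) l, ipi V (mrs N h l) = rs O h (ipi U l);
  ipi_inj : forall U, injective (ipi U);
  ipi_im : forall U, range (ipi U) = ker_pow q m U
}.

(** * Cocycles and vector bundles *)

Record cocycle (T : topologicalType) (O : ring_sheaf T) (r : nat) := Cocycle {
  ix : Type;
  cov : ix -> opens T;
  cov_total : forall x, exists i, oset (cov i) x;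
  tr : forall i j, 'M[O (ocap (cov i) (cov j))]_r;
  tr_GL : forall i j, in_GL (tr i j);
  tr_cocycle : forall i j k (W : opens T)
    (hij : W `<=` ocap (cov i) (cov j)) (hjk : W `<=` ocap (cov j) (cov k))
    (hik : W `<=` ocap (cov i) (cov k)),
    map_mx (rs O hij) (tr i j) *m map_mx (rs O hjk) (tr j k) =
    map_mx (rs O hik) (tr i k)
}.

(* theta'_kl = h_k theta_kl h_l^-1 on a common refinement of the covers. *)
Definition cohomologous (T : topologicalType) (O : ring_sheaf T) (r : nat)
    (c c' : cocycle O r) : Prop :=
  exists (K : Type) (W : K -> opens T) (a : K -> ix c) (b : K -> ix c')
         (h : forall k, 'M[O (W k)]_r),
    [/\ (forall x, exists k, oset (W k) x),
        (forall k, W k `<=` cov (a k)) /\ (forall k, W k `<=` cov (b k)),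
        (forall k, in_GL (h k)) &
        (forall k l (V : opens T) (Vk : V `<=` W k) (Vl : V `<=` W l)
            (Va : V `<=` ocap (cov (a k)) (cov (a l)))
            (Vb : V `<=` ocap (cov (b k)) (cov (b l))),
           map_mx (rs O Vb) (tr (b k) (b l)) *m map_mx (rs O Vl) (h l) =
           map_mx (rs O Vk) (h k) *m map_mx (rs O Va) (tr (a k) (a l)))].

(* The set H^1(T, GL(r, O)), as the set of equivalence classes of cocycles. *)
Record H1_GL (T : topologicalType) (O : ring_sheaf T) (r : nat) := H1GL {
  represents : cocycle O r -> Prop;
  represents_class : exists c, forall c', represents c' <-> cohomologous c c'
}.

(* [c] is the cocycle of transition matrices of local trivializations
   psi_i : F|U_i -> O^r|U_i, that is psi_i = theta_ij psi_j. *)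
Definition has_transition (T : topologicalType) (O : ring_sheaf T) (r : nat)
    (c : cocycle O r) (F : mod_sheaf O) : Prop :=
  exists psi : forall (i : ix c) (U : opens T), U `<=` cov i ->
                 {linear F U -> 'cV[O U]_r},
    [/\ (forall i U h, bijective (psi i U h)),
        (forall i (U V : opens T) (h : U `<=` cov i) (k : V `<=` U) (l : V `<=` cov i) x,
           psi i V l (mrs F k x) = map_mx (rs O k) (psi i U h x)) &
        (forall i j (U : opens T) (hi : U `<=` cov i) (hj : U `<=` cov j)
            (hij : U `<=` ocap (cov i) (cov j)) x,
           psi i U hi x = map_mx (rs O hij) (tr i j) *m psi j U hj x)].

(* F is a rank r vector bundle with class g. *)
Definition corresponding_bundle (T : topologicalType) (O : ring_sheaf T)
    (r : nat) (g : H1_GL O r) (F : mod_sheaf O) : Prop :=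
  exists2 c, represents g c & has_transition c F.

(** * The twisted sheaf *)

Section Twist.
Context (R : realType) (T : topologicalType) (O1 On OX : alg_sheaf R T).
Context (p : alg_hom O1 On) (q1 : alg_hom O1 OX) (n r : nat).
Context (N : mod_sheaf OX) (phi : ideal_pow_iso q1 n N).

(* The inclusion of M(r, N) in GL(r, O1). *)
Definition ker_incl (U : opens T) (gam : 'M[N U]_r) : 'M[O1 U]_r :=
  1%:M + map_mx (phi U) gam.

(* [gam'] is the image of [gam] by the action of [theta] induced by conjugation
   in GL(r, O1), computed with the local liftings of [theta] to GL(r, O1). *)
Definition acts_to (U : opens T) (theta : 'M[On U]_r) (gam gam' : 'M[N U]_r) :
  Prop :=
  forall (V : opens T) (h : V `<=` U) (lift inv : 'M[O1 V]_r),
    inverses_mx lift inv -> map_mx (p V) lift = map_mx (rs On h) theta ->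
    lift *m ker_incl (map_mx (mrs N h) gam) *m inv =
    ker_incl (map_mx (mrs N h) gam').

(* M is obtained by gluing the sheaves M(r, N)|U_i by means of the action of the
   theta_ij: there are isomorphisms psi_i : M|U_i -> M(r, N)|U_i of sheaves of
   OX-modules such that psi_i = theta_ij . psi_j over U_i and U_j. *)
Definition is_twisted_sheaf (c : cocycle On r) (M : mod_sheaf OX) : Prop :=
  exists psi : forall (i : ix c) (U : opens T), U `<=` cov i ->
                 {additive M U -> 'M[N U]_r},
    [/\ (forall i U h a x,
           psi i U h (a *: x) = map_mx ( *:%R a) (psi i U h x)),
        (forall i U h, bijective (psi i U h)),
        (forall i (U V : opens T) (h : U `<=` cov i) (k : V `<=` U) (l : V `<=` cov i) x,
           psi i V l (mrs M k x) = map_mx (mrs N k) (psi i U h x)) &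
        (forall i j (U : opens T) (hi : U `<=` cov i) (hj : U `<=` cov j)
            (hij : U `<=` ocap (cov i) (cov j)) x,
           acts_to (map_mx (rs On hij) (tr i j)) (psi j U hj x)
             (psi i U hi x))].

End Twist.

(* Main.v *)
(* Over an open set where E has a frame (e_a), with dual frame (f_a), let a
   matrix of sections g_ab of L^n correspond to the sum of the tensors of f_b,
   e_a and g_ab. Changing the frame by a matrix A turns g into A g A^-1. On the
   other side, theta acts on I + M(r, I_X^n) by conjugation with a lift of theta
   to X_(n+1), which depends only on the restriction A of theta to X, because
   I_X annihilates I_X^n. Hence the local identifications glue. The inverse
   morphism, from the tensor product to the twisted sheaf, comes from the
   universal properties through the sheaf Hom(L^n, M). *)

Require Import Defs.
From HB Require Import structures.
From mathcomp Require Import all_boot all_order all_algebra complex.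
From mathcomp Require Import boolp classical_sets reals topology.

Set Implicit Arguments.
Unset Strict Implicit.
Unset Printing Implicit Defensive.

Import GRing.Theory.
Local Open Scope classical_set_scope.
Local Open Scope ring_scope.

(** Tensor products and duals are given only by universal properties, so [EdualELn] comes with no
    local description. The morphism out of [M] is therefore glued from formulas in frames, while the
    one into [M] is the lift of a trilinear map, and the two composites are checked by different
    means: in the charts of [M] for one, on tensors for the other. A second obstacle is that a class
    in H^1 has many representatives: the cocycle trivializing [EE] and the cocycle [theta] defining
    the twist may live on different covers. Frames of [EE] are carried along the cohomologies until
    their change of frame matrices are exactly restrictions of the matrices of [theta]; only then
    are both sides glued by the same data. Finally, the action on M(r, L^n) is specified through
    liftings to X_(n+1), so invertible liftings must exist locally. They do because the kernel of
    [p] is contained in I_X and in I_X^n, hence has square zero. *)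

Lemma ocapl (T : topologicalType) (U V : opens T) : ocap U V `<=` U.
Proof. exact: subIsetl. Qed.

Lemma ocapr (T : topologicalType) (U V : opens T) : ocap U V `<=` V.
Proof. exact: subIsetr. Qed.

Lemma sub_ocap (T : topologicalType) (U V W : opens T) :
  W `<=` U -> W `<=` V -> W `<=` ocap U V.
Proof. by move=> ? ?; rewrite subsetI. Qed.

(** A predicate replaces a compatible family: the cover is indexed by all triples of an open set,
    its inclusion and a section satisfying [P], and uniqueness together with stability under
    restriction gives agreement on overlaps. No coherent choice of local sections is needed. *)
Lemma sheaf_glue (T : topologicalType) (F : opens T -> Type)
    (res : forall U V : opens T, V `<=` U -> F U -> F V) (U : opens T)
    (P : forall V : opens T, F V -> Prop) :
  sheaf_axiom res ->
  (forall (V W : opens T) (h : W `<=` V) s, P V s -> P W (res V W h s)) ->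
  (forall (V : opens T) s s', P V s -> P V s' -> s = s') ->
  (forall x, oset U x -> exists (V : opens T) (h : V `<=` U) s,
     oset V x /\ P V s) ->
  exists s : F U, forall (V : opens T) (h : V `<=` U) s',
    P V s' -> res U V h s = s'.
Proof.
move=> Fsh Pres Puniq Pex.
pose I := {V : opens T & {h : V `<=` U & {s : F V | P V s}}}.
pose V (i : I) := projT1 i; pose h (i : I) : V i `<=` U := projT1 (projT2 i).
pose s (i : I) : F (V i) := projT1 (projT2 (projT2 i)).
have Ps i : P (V i) (s i) := projT2 (projT2 (projT2 i)).
have [x|i j W hi hj|t [tP _]] := Fsh I V U h _ s.
- by case/Pex=> W [k [u [Wx Pu]]]; exists (existT _ W (existT _ k (exist _ u Pu))).
- by apply: Puniq; apply: Pres.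
exists t => W k u Pu.
exact: (tP (existT _ W (existT _ k (exist _ u Pu)))).
Qed.

(** Over the open sets where they agree, [s] and [s'] glue the same family, so the uniqueness half
    of the sheaf axiom identifies them. *)
Lemma sheaf_sep (T : topologicalType) (F : opens T -> Type)
    (res : forall U V : opens T, V `<=` U -> F U -> F V) (U : opens T)
    (s s' : F U) :
  sheaf_axiom res ->
  (forall (U V W : opens T) (h : V `<=` U) (k : W `<=` V) (l : W `<=` U) s,
     res V W k (res U V h s) = res U W l s) ->
  (forall x, oset U x -> exists (V : opens T) (h : V `<=` U),
     oset V x /\ res U V h s = res U V h s') -> s = s'.
Proof.
move=> Fsh rescomp eqs.
pose I := {V : opens T & {h : V `<=` U | res U V h s = res U V h s'}}.
pose V (i : I) := projT1 i; pose h (i : I) : V i `<=` U := proj1_sig (projT2 i).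
have [x|i j W hi hj|t [_ tP]] := Fsh I V U h _ (fun i => res U (V i) (h i) s).
- by case/eqs=> W [k [Wx e]]; exists (existT _ W (exist _ k e)).
- have l : W `<=` U by move=> y /hi; exact: h.
  by rewrite !(rescomp _ _ _ _ _ l).
rewrite -(tP s) // -(tP s') // => i.
exact/esym/(proj2_sig (projT2 i)).
Qed.

Lemma mod_glue (T : topologicalType) (O : ring_sheaf T) (M : mod_sheaf O)
    (U : opens T) (P : forall V : opens T, M V -> Prop) :
  (forall (V W : opens T) (h : W `<=` V) s, P V s -> P W (mrs M h s)) ->
  (forall (V : opens T) s s', P V s -> P V s' -> s = s') ->
  (forall x, oset U x -> exists (V : opens T) (h : V `<=` U) s,
     oset V x /\ P V s) ->
  exists s : M U, forall (V : opens T) (h : V `<=` U) s',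
    P V s' -> mrs M h s = s'.
Proof. exact: (sheaf_glue (@mrs_sheaf T O M)). Qed.

Lemma mod_sep (T : topologicalType) (O : ring_sheaf T) (M : mod_sheaf O)
    (U : opens T) (s s' : M U) :
  (forall x, oset U x -> exists (V : opens T) (h : V `<=` U),
     oset V x /\ mrs M h s = mrs M h s') -> s = s'.
Proof. exact: (sheaf_sep (@mrs_sheaf T O M) (@mrs_comp T O M)). Qed.

Lemma ring_sep (T : topologicalType) (O : ring_sheaf T) (U : opens T)
    (s s' : O U) :
  (forall x, oset U x -> exists (V : opens T) (h : V `<=` U),
     oset V x /\ rs O h s = rs O h s') -> s = s'.
Proof. exact: (sheaf_sep (@rs_sheaf T O) (@rs_comp T O)). Qed.

(** * The sheaf of homomorphisms Hom(N, K) *)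

Section LocalHom.
Context (T : topologicalType) (O : ring_sheaf T) (N K : mod_sheaf O).

Record local_hom (U : opens T) := LocalHom {
  lh :> forall V : opens T, V `<=` U -> N V -> K V;
  lh_lin : forall (V : opens T) (h : V `<=` U) a x y,
    lh h (a *: x + y) = a *: lh h x + lh h y;
  lh_rs : forall (V W : opens T) (h : V `<=` U) (k : W `<=` V) (l : W `<=` U) x,
    lh l (mrs N k x) = mrs K k (lh h x)
}.

Lemma local_homP (U : opens T) (f g : local_hom U) :
  (forall (V : opens T) (h : V `<=` U) x, lh f h x = lh g h x) -> f = g.
Proof.
case: f g => [f f1 f2] [g g1 g2] /= fg.
have {}fg : f = g by do 3 apply: functional_extensionality_dep => ?.
by case: g / fg g1 g2 => g1 g2; congr LocalHom; exact: Prop_irrelevance.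
Qed.

HB.instance Definition _ (U : opens T) := gen_eqMixin (local_hom U).
HB.instance Definition _ (U : opens T) := gen_choiceMixin (local_hom U).

Context (U : opens T).

Definition local_hom0 : local_hom U.
Proof.
refine (@LocalHom U (fun V _ _ => 0) _ _) => [*|*].
  by rewrite scaler0 addr0.
by rewrite raddf0.
Defined.

Definition local_homN (f : local_hom U) : local_hom U.
Proof.
refine (@LocalHom U (fun V h x => - lh f h x) _ _) => [*|V W h k l x].
  by rewrite lh_lin opprD scalerN.
by rewrite raddfN (lh_rs f h k l).
Defined.

Definition local_homD (f g : local_hom U) : local_hom U.
Proof.
refine (@LocalHom U (fun V h x => lh f h x + lh g h x) _ _)
  => [*|V W h k l x].
  by rewrite !lh_lin scalerDr addrACA.
by rewrite raddfD (lh_rs f h k l) (lh_rs g h k l).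
Defined.

Definition local_homZ (a : O U) (f : local_hom U) : local_hom U.
Proof.
refine (@LocalHom U (fun V h x => rs O h a *: lh f h x) _ _)
  => [*|V W h k l x].
  by rewrite lh_lin scalerDr !scalerA mulrC.
by rewrite (lh_rs f h k l) mrs_scale (rs_comp _ _ l).
Defined.

Fact local_homDA : associative local_homD.
Proof. by move=> f g k; apply: local_homP => V h x /=; rewrite addrA. Qed.
Fact local_homDC : commutative local_homD.
Proof. by move=> f g; apply: local_homP => V h x /=; rewrite addrC. Qed.
Fact local_hom0D : left_id local_hom0 local_homD.
Proof. by move=> f; apply: local_homP => V h x /=; rewrite add0r. Qed.
Fact local_homND : left_inverse local_hom0 local_homN local_homD.
Proof. by move=> f; apply: local_homP => V h x /=; rewrite addNr. Qed.

HB.instance Definition _ := GRing.isZmodule.Build (local_hom U)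
  local_homDA local_homDC local_hom0D local_homND.

Fact local_homZA a b (f : local_hom U) :
  local_homZ a (local_homZ b f) = local_homZ (a * b) f.
Proof. by apply: local_homP => V h x /=; rewrite scalerA rmorphM. Qed.
Fact local_hom1Z : left_id 1 local_homZ.
Proof. by move=> f; apply: local_homP => V h x /=; rewrite rmorph1 scale1r. Qed.
Fact local_homZDr : right_distributive local_homZ +%R.
Proof. by move=> a f g; apply: local_homP => V h x /=; rewrite scalerDr. Qed.
Fact local_homZDl (f : local_hom U) : {morph local_homZ^~ f : a b / a + b}.
Proof. by move=> a b; apply: local_homP => V h x /=; rewrite rmorphD scalerDl. Qed.

HB.instance Definition _ := GRing.Zmodule_isLmodule.Build (O U) (local_hom U)
  local_homZA local_hom1Z local_homZDr local_homZDl.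

End LocalHom.

Section HomModSheaf.
Context (T : topologicalType) (O : ring_sheaf T) (N K : mod_sheaf O).

Definition local_hom_res (U V : opens T) (h : V `<=` U) (f : local_hom N K U) :
  local_hom N K V.
Proof.
refine (@LocalHom T O N K V (fun W k x => lh f (subset_trans k h) x) _ _)
  => [*|W W' k l m x].
  exact: lh_lin.
exact: lh_rs.
Defined.

Fact local_hom_res_additive (U V : opens T) (h : V `<=` U) :
  zmod_morphism (local_hom_res h).
Proof. by move=> f g; apply: local_homP. Qed.

HB.instance Definition _ (U V : opens T) (h : V `<=` U) :=
  GRing.isZmodMorphism.Build _ _ (local_hom_res h) (local_hom_res_additive h).

Lemma lh_irr (U V : opens T) (f : local_hom N K U) (h k : V `<=` U) x :
  lh f h x = lh f k x.
Proof. by rewrite (Prop_irrelevance h k). Qed.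

(** The value of the glued morphism at [x] is itself glued in [K], from the values of the [s i] at
    restrictions of [x]. Linearity, compatibility with restriction and uniqueness are then tested on
    open sets contained in some [V i], where these values are known. *)
Lemma local_hom_sheaf : sheaf_axiom local_hom_res.
Proof.
move=> I V U sVU cov s compat.
have sE i j (W : opens T) (hi : W `<=` V i) (hj : W `<=` V j) x :
    lh (s i) hi x = lh (s j) hj x.
  have /(congr1 (fun f => lh f (@subset_refl _ W) x)) /= := compat i j W hi hj.
  by rewrite (lh_irr (s i) _ hi) (lh_irr (s j) _ hj).
have glue (W : opens T) (hW : W `<=` U) (x : N W) : exists y : K W,
    forall (W' : opens T) (k : W' `<=` W) i (l : W' `<=` V i),
      mrs K k y = lh (s i) l (mrs N k x).
  pose P (W' : opens T) (y : K W') := exists (k : W' `<=` W) i (l : W' `<=` V i),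
    y = lh (s i) l (mrs N k x).
  have [||w Ww|y yP] := mod_glue (U := W) (P := P).
  - move=> W1 W2 h y [k [i [l ->]]].
    have k2 : W2 `<=` W by exact: subset_trans k.
    have l2 : W2 `<=` V i by exact: subset_trans l.
    by exists k2, i, l2; rewrite -(lh_rs (s i) l h l2) (mrs_comp _ _ k2).
  - move=> W1 y y' [k [i [l ->]]] [k' [i' [l' ->]]].
    by rewrite (Prop_irrelevance k' k); exact: sE.
  - have [i Vw] := cov w (hW w Ww).
    exists (ocap W (V i)), (@ocapl _ _ _).
    exists (lh (s i) (@ocapr _ _ _) (mrs N (@ocapl _ _ _) x)).
    by split=> //; exists (@ocapl _ _ _), i, (@ocapr _ _ _).
  by exists y => W' k i l; apply: yP; exists k, i, l.
pose y (W : opens T) (hW : W `<=` U) x := projT1 (cid (glue W hW x)).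
have yP (W : opens T) (hW : W `<=` U) x : forall (W' : opens T) (k : W' `<=` W) i (l : W' `<=` V i),
   mrs K k (y W hW x) = lh (s i) l (mrs N k x) := projT2 (cid (glue W hW x)).
have sep (W : opens T) (hW : W `<=` U) (y1 y2 : K W) :
    (forall (W' : opens T) (k : W' `<=` W) i (l : W' `<=` V i), mrs K k y1 = mrs K k y2) ->
    y1 = y2.
  move=> e; apply: mod_sep => w Ww; have [i Vw] := cov w (hW w Ww).
  by exists (ocap W (V i)), (@ocapl _ _ _); split=> //; apply: (e _ _ i) (@ocapr _ _ _).
unshelve eexists; first unshelve eexists.
- exact: y.
- move=> W hW a u v; apply: sep => // W' k i l.
  rewrite (yP _ _ _ _ _ i l) !raddfD /= !mrs_scale !(yP _ _ _ _ _ i l).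
  by rewrite lh_lin.
- move=> W W' h k l u; apply: sep => // W1 k1 i l1.
  have k2 : W1 `<=` W by exact: subset_trans k.
  by rewrite (yP _ _ _ _ _ i l1) !(mrs_comp _ _ k2) (yP _ _ _ _ _ i l1).
split=> [i|t tP].
  apply: local_homP => W h x /=.
  by rewrite -[LHS](mrs_id (@subset_refl _ W)) (yP _ _ _ _ _ i h) mrs_id.
apply: local_homP => W h x /=; apply: sep => // W' k i l.
rewrite (yP _ _ _ _ _ i l) -(tP i) /= -(lh_rs t h k (subset_trans k h)).
exact: lh_irr.
Qed.

Definition hom_sheaf : mod_sheaf O.
Proof.
refine (@ModSheaf T O (fun U => local_hom N K U : lmodType (O U))
  (fun U V h => local_hom_res h : {additive _ -> _}) _ _ _ local_hom_sheaf).
- by move=> U V h a f; apply: local_homP => W k x /=; rewrite (rs_comp _ _ (subset_trans k h)).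
- by move=> U h f; apply: local_homP => W k x /=; exact: lh_irr.
- by move=> U V W h k l f; apply: local_homP => W' k' x /=; exact: lh_irr.
Defined.

End HomModSheaf.

Definition mod_hom_of (T : topologicalType) (O : ring_sheaf T)
    (F G : mod_sheaf O) (f : forall U : opens T, F U -> G U)
    (f_lin : forall (U : opens T) a x y, f U (a *: x + y) = a *: f U x + f U y)
    (f_rs : forall (U V : opens T) (h : V `<=` U) x,
      f V (mrs F h x) = mrs G h (f U x)) : mod_hom F G.
Proof.
refine (@ModHom T O F G (fun U => HB.pack_for {linear F U -> G U} (f U)
  (GRing.isLinear.Build (O U) (F U) (G U) *:%R (f U) (f_lin U))) _).
exact: f_rs.
Defined.

(** * Tensor products of three sheaves and the tensor-Hom adjunction *)

Record trilinear_map (T : topologicalType) (O : ring_sheaf T)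
    (D E N K : mod_sheaf O) := TrilinearMap {
  tl :> forall U : opens T, D U -> E U -> N U -> K U;
  tl_lin1 : forall U a (x x' : D U) y l,
    tl (a *: x + x') y l = a *: tl x y l + tl x' y l;
  tl_lin2 : forall U a (x : D U) y y' l,
    tl x (a *: y + y') l = a *: tl x y l + tl x y' l;
  tl_lin3 : forall U a (x : D U) y l l',
    tl x y (a *: l + l') = a *: tl x y l + tl x y l';
  tl_rs : forall (U V : opens T) (h : V `<=` U) (x : D U) y l,
    tl (mrs D h x) (mrs E h y) (mrs N h l) = mrs K h (tl x y l)
}.

(** The uniqueness clause of [is_tensor] becomes available once some bilinear map into [K] is
    supplied; the composite of [b] and [f] serves. *)
Lemma tensor_ext (T : topologicalType) (O : ring_sheaf T)
    (F G H K : mod_sheaf O) (b : bilinear_map F G H) (f g : mod_hom H K) :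
  is_tensor b -> (forall U x y, f U (b U x y) = g U (b U x y)) ->
  forall U z, f U z = g U z.
Proof.
move=> b_tensor fg.
suff c : bilinear_map F G K by have [_] := b_tensor K c; exact.
refine (@BilinearMap T O F G K (fun U x y => f U (b U x y)) _ _ _).
- by move=> U a x x' y; rewrite bl_linl linearP.
- by move=> U a x y y'; rewrite bl_linr linearP.
- by move=> U V h x y; rewrite bl_rs mh_rs.
Qed.

Section TripleTensor.
Context (T : topologicalType) (O : ring_sheaf T) (D E N H P K : mod_sheaf O).
Context (b1 : bilinear_map D E H) (b2 : bilinear_map H N P).
Hypotheses (b1_tensor : is_tensor b1) (b2_tensor : is_tensor b2).

Definition curry_trilinear (t : trilinear_map D E N K) :
  bilinear_map D E (hom_sheaf N K).
Proof.
unshelve refine (@BilinearMap T O D E (hom_sheaf N K) (fun U x y =>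
  @LocalHom T O N K U (fun V h l => t V (mrs D h x) (mrs E h y) l) _ _) _ _ _).
- by move=> V h a l l'; exact: tl_lin3.
- by move=> V W h k m l /=; rewrite -(tl_rs t k) !(mrs_comp _ _ m).
- move=> U a x x' y; apply: local_homP => V h l /=.
  by rewrite raddfD /= mrs_scale tl_lin1.
- move=> U a x y y'; apply: local_homP => V h l /=.
  by rewrite raddfD /= mrs_scale tl_lin2.
- move=> U V h x y; apply: local_homP => W k l /=.
  by rewrite !(mrs_comp _ _ (subset_trans k h)).
Defined.

Definition uncurry (F : mod_sheaf O) (f : mod_hom F (hom_sheaf N K)) :
  bilinear_map F N K.
Proof.
refine (@BilinearMap T O F N K
  (fun U x l => lh (f U x : local_hom N K U) (@subset_refl _ U) l) _ _ _).
- by move=> U a x x' l; rewrite linearP /= rs_id.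
- by move=> U a x l l'; rewrite lh_lin.
- move=> U V h x l; rewrite mh_rs /=.
  rewrite -(lh_rs (f U x : local_hom N K U) (@subset_refl _ U) h h).
  exact: lh_irr.
Defined.

(** Currying turns [t] into a bilinear map with values in Hom(N, K), which factors through [H];
    uncurrying gives a bilinear map on [H] and [N], which factors through [P]. The detour is needed
    because [b2] asks for a value at every section of [H], not only at tensors. *)
Lemma triple_tensor_lift (t : trilinear_map D E N K) :
  exists f : mod_hom P K, forall U x y l, f U (b2 U (b1 U x y) l) = t U x y l.
Proof.
have [[f1 f1E] _] := b1_tensor (curry_trilinear t).
have [[f fE] _] := b2_tensor (uncurry f1).
by exists f => U x y l; rewrite fE /= f1E /= !mrs_id.
Qed.

Definition curry_hom (f : mod_hom P K) : mod_hom H (hom_sheaf N K).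
Proof.
unshelve refine (@mod_hom_of T O H (hom_sheaf N K) (fun U z =>
  @LocalHom T O N K U (fun V h l => f V (b2 V (mrs H h z) l)) _ _) _ _).
- by move=> V h a l l'; rewrite bl_linr linearP.
- by move=> V W h k m l /=; rewrite -mh_rs -bl_rs (mrs_comp _ _ m).
- move=> U a x x'; apply: local_homP => V h l /=.
  by rewrite raddfD /= mrs_scale bl_linl linearP.
- move=> U V h x; apply: local_homP => W k l /=.
  by rewrite (mrs_comp _ _ (subset_trans k h)).
Defined.

(** The same detour for uniqueness: agreement on tensors of [H] and [N] amounts to equality of two
    morphisms from [H] to Hom(N, K), which is tested on tensors of [D] and [E]. *)
Lemma triple_tensor_ext (f g : mod_hom P K) :
  (forall U x y l, f U (b2 U (b1 U x y) l) = g U (b2 U (b1 U x y) l)) ->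
  forall U z, f U z = g U z.
Proof.
move=> fg; apply: (tensor_ext b2_tensor) => U z l.
suff /(congr1 (fun k : local_hom N K U => lh k (@subset_refl _ U) l)) :
  curry_hom f U z = curry_hom g U z by rewrite /= !mrs_id.
apply: (tensor_ext b1_tensor) => {l}V x y; apply: local_homP => W h l /=.
by rewrite -bl_rs fg.
Qed.

End TripleTensor.

(** * Frames and dual frames *)

Lemma mrs_sum (T : topologicalType) (O : ring_sheaf T) (M : mod_sheaf O)
    (U V : opens T) (h : V `<=` U) (I : finType) (c : I -> O U) (x : I -> M U) :
  mrs M h (\sum_i c i *: x i) = \sum_i rs O h (c i) *: mrs M h (x i).
Proof. by rewrite raddf_sum; apply: eq_bigr => i _; rewrite mrs_scale. Qed.

Section LinearSums.
Context (A : pzRingType) (V W : lmodType A) (f : V -> W).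
Hypothesis f_lin : forall a x y, f (a *: x + y) = a *: f x + f y.

Lemma lin_additive : {morph f : x y / x + y}.
Proof. by move=> x y; have := f_lin 1 x y; rewrite !scale1r. Qed.

Lemma lin_zero : f 0 = 0.
Proof.
have /eqP := lin_additive 0 0; rewrite addr0.
by rewrite eq_sym -subr_eq0 addrK => /eqP.
Qed.

Lemma lin_scale a x : f (a *: x) = a *: f x.
Proof. by have := f_lin a x 0; rewrite lin_zero !addr0. Qed.

Lemma lin_bigsum (I : finType) (x : I -> V) : f (\sum_i x i) = \sum_i f (x i).
Proof. exact: (big_morph f lin_additive lin_zero). Qed.

Lemma lin_lincomb (I : finType) (c : I -> A) (x : I -> V) :
  f (\sum_i c i *: x i) = \sum_i c i *: f (x i).
Proof. by rewrite lin_bigsum; apply: eq_bigr => i _; rewrite lin_scale. Qed.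

End LinearSums.

Section Bilinear.
Context (T : topologicalType) (O : ring_sheaf T) (F G H : mod_sheaf O).
Context (b : bilinear_map F G H) (U : opens T).

Lemma bl_suml (I : finType) (c : I -> O U) (x : I -> F U) y :
  b U (\sum_i c i *: x i) y = \sum_i c i *: b U (x i) y.
Proof. by apply: (lin_lincomb (f := b U ^~ y)) => *; exact: bl_linl. Qed.

Lemma bl_sumr (I : finType) (c : I -> O U) x (y : I -> G U) :
  b U x (\sum_i c i *: y i) = \sum_i c i *: b U x (y i).
Proof. by apply: lin_lincomb => *; exact: bl_linr. Qed.

End Bilinear.

Section Trilinear.
Context (T : topologicalType) (O : ring_sheaf T) (D E N K : mod_sheaf O).
Context (t : trilinear_map D E N K) (U : opens T).

Lemma tl_scale3 a x y l : t U x y (a *: l) = a *: t U x y l.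
Proof. by apply: lin_scale => *; exact: tl_lin3. Qed.

Lemma tl_sum3 (I : finType) x y (l : I -> N U) :
  t U x y (\sum_i l i) = \sum_i t U x y (l i).
Proof. by apply: lin_bigsum => *; exact: tl_lin3. Qed.

Lemma tl_sum12 (I J : finType) (c : I -> O U) (x : I -> D U)
    (c' : J -> O U) (y : J -> E U) l :
  t U (\sum_i c i *: x i) (\sum_j c' j *: y j) l =
  \sum_j \sum_i t U (x i) (y j) ((c' j * c i) *: l).
Proof.
rewrite (lin_lincomb (f := fun y => t U _ y l)); last by move=> *; exact: tl_lin2.
apply: eq_bigr => j _; rewrite (lin_lincomb (f := fun x => t U x _ l)); last first.
  by move=> *; exact: tl_lin1.
by rewrite scaler_sumr; apply: eq_bigr => i _; rewrite scalerA tl_scale3.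
Qed.

End Trilinear.

Section Frame.
Context (T : topologicalType) (O : ring_sheaf T) (E : mod_sheaf O) (r : nat).

Definition lincomb (W V : opens T) (e : 'I_r -> E W) (h : V `<=` W)
    (c : 'I_r -> O V) : E V :=
  \sum_a c a *: mrs E h (e a).

(** Bijectivity is required over every smaller open set, so that a frame is a trivialization of the
    restricted sheaf and not merely a basis of its sections over [W]. *)
Definition frame (W : opens T) (e : 'I_r -> E W) : Prop :=
  forall (V : opens T) (h : V `<=` W), bijective (lincomb e h).

Context (W : opens T) (e : 'I_r -> E W).

Lemma mrs_lincomb (V V' : opens T) (h : V `<=` W) (h' : V' `<=` W)
    (k : V' `<=` V) (c : 'I_r -> O V) :
  mrs E k (lincomb e h c) = lincomb e h' (fun a => rs O k (c a)).
Proof. by rewrite mrs_sum; apply: eq_bigr => a _; rewrite (mrs_comp _ _ h'). Qed.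

Hypothesis e_frame : frame e.

Definition frame_coord (V : opens T) (h : V `<=` W) : E V -> 'I_r -> O V :=
  projT1 (cid2 (let: Bijective g gK Kg := e_frame h in
    ex_intro2 (fun g => cancel (lincomb e h) g)
              (fun g => cancel g (lincomb e h)) g gK Kg)).

Lemma lincombK (V : opens T) (h : V `<=` W) :
  cancel (lincomb e h) (frame_coord h).
Proof. by rewrite /frame_coord; case: cid2. Qed.

Lemma frame_coordK (V : opens T) (h : V `<=` W) :
  cancel (frame_coord h) (lincomb e h).
Proof. by rewrite /frame_coord; case: cid2. Qed.

Lemma frame_coord_lin (V : opens T) (h : V `<=` W) c (x y : E V) a :
  frame_coord h (c *: x + y) a = c * frame_coord h x a + frame_coord h y a.
Proof.
rewrite -{1}[x](frame_coordK h) -{1}[y](frame_coordK h).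
have -> : c *: lincomb e h (frame_coord h x) + lincomb e h (frame_coord h y) =
    lincomb e h (fun a => c * frame_coord h x a + frame_coord h y a).
  rewrite scaler_sumr -big_split; apply: eq_bigr => b _ /=.
  by rewrite scalerDl scalerA.
by rewrite lincombK.
Qed.

Lemma frame_coord_rs (V V' : opens T) (h : V `<=` W) (h' : V' `<=` W)
    (k : V' `<=` V) (x : E V) a :
  frame_coord h' (mrs E k x) a = rs O k (frame_coord h x a).
Proof. by rewrite -{1}[x](frame_coordK h) (mrs_lincomb h h') lincombK. Qed.

Lemma frame_coord_frame (V : opens T) (h : V `<=` W) a b :
  frame_coord h (mrs E h (e b)) a = (a == b)%:R.
Proof.
have -> : mrs E h (e b) = lincomb e h (fun a => (a == b)%:R).
  rewrite /lincomb (bigD1 b) //= eqxx scale1r big1 ?addr0 // => c /negPf ->.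
  by rewrite scale0r.
by rewrite lincombK.
Qed.

End Frame.

(** The condition that [is_dual] puts on an evaluation, separated from its existence so that one
    [ev] can be fixed. *)
Definition dual_evaluation (T : topologicalType) (O : ring_sheaf T)
    (E D : mod_sheaf O) (ev : bilinear_map D E (struct_mod O)) : Prop :=
  forall (U : opens T)
  (f : forall V : opens T, V `<=` U -> E V -> O V),
  (forall (V : opens T) (h : V `<=` U) a x y,
     f V h (a *: x + y) = a * f V h x + f V h y) ->
  (forall (V W : opens T) (h : V `<=` U) (k : W `<=` V) (l : W `<=` U) x,
     f W l (mrs E k x) = rs O k (f V h x)) ->
  exists! d : D U, forall (V : opens T) (h : V `<=` U) x,
    ev V (mrs D h d) x = f V h x.

Section Dual.
Context (T : topologicalType) (O : ring_sheaf T) (E D : mod_sheaf O).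
Context (ev : bilinear_map D E (struct_mod O)).
Hypothesis ev_dual : dual_evaluation ev.

Lemma dual_ext (U : opens T) (d d' : D U) :
  (forall (V : opens T) (h : V `<=` U) x,
     ev V (mrs D h d) x = ev V (mrs D h d') x) -> d = d'.
Proof.
move=> dd'.
have [V h a x y|V W h k l x|d0 [_ d0_uniq]] :=
    ev_dual (f := fun V (h : V `<=` U) x => ev V (mrs D h d') x).
- exact: (bl_linr ev a _ x y).
- by rewrite -(mrs_comp h k) bl_rs.
by rewrite -(d0_uniq d) // -(d0_uniq d').
Qed.

Context (r : nat) (W : opens T) (e : 'I_r -> E W) (e_frame : frame e).

Lemma dual_coord_subproof b : exists! d : D W,
  forall (V : opens T) (h : V `<=` W) x, ev V (mrs D h d) x = frame_coord e_frame h x b.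
Proof.
by apply: ev_dual => *; [exact: frame_coord_lin|exact: frame_coord_rs].
Qed.

Definition dual_coord b : D W := projT1 (cid (dual_coord_subproof b)).

Lemma dual_coordE b (V : opens T) (h : V `<=` W) x :
  ev V (mrs D h (dual_coord b)) x = frame_coord e_frame h x b.
Proof. by rewrite /dual_coord; case: cid => d [/= + _]; exact. Qed.

Lemma dual_coord_sum (V : opens T) (h : V `<=` W) (d : D V) :
  d = \sum_b (ev V d (mrs E h (e b)) : O V) *: mrs D h (dual_coord b).
Proof.
apply: dual_ext => V' k x.
have h' : V' `<=` W by exact: subset_trans h.
rewrite mrs_sum bl_suml -{1}[x](frame_coordK e_frame h') bl_sumr.
apply: eq_bigr => b _; rewrite (mrs_comp _ _ h') dual_coordE.
by rewrite -(bl_rs ev k d) (mrs_comp _ _ h') [LHS]mulrC.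
Qed.

End Dual.

(** * Gluing matrices by conjugation *)

(** The product P g Q for a matrix [g] with entries in a module; it is conjugation when [Q] is the
    inverse of [P]. *)
Definition mxact (A : comPzRingType) (N : lmodType A) (r : nat)
    (P Q : 'M[A]_r) (g : 'M[N]_r) : 'M[N]_r :=
  \matrix_(a, b) \sum_c \sum_d (P a c * Q d b) *: g c d.

Section TwistedHom.
Context (T : topologicalType) (O : ring_sheaf T) (r : nat).
Context (E D N M H P : mod_sheaf O).
Context (ev : bilinear_map D E (struct_mod O)).
Hypothesis ev_dual : dual_evaluation ev.
Context (b1 : bilinear_map D E H) (b2 : bilinear_map H N P).
Hypotheses (b1_tensor : is_tensor b1) (b2_tensor : is_tensor b2).
Context (K : Type) (W : K -> opens T) (e : forall k, 'I_r -> E (W k)).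
Hypothesis W_cover : forall x, exists k, oset (W k) x.
Hypothesis e_frame : forall k, frame (e k).
Context (psi : forall k (V : opens T), V `<=` W k -> {additive M V -> 'M[N V]_r}).
Hypothesis psiZ : forall k (V : opens T) (h : V `<=` W k) a x,
  psi h (a *: x) = map_mx ( *:%R a) (psi h x).
Hypothesis psi_bij : forall k (V : opens T) (h : V `<=` W k),
  bijective (psi h).
Hypothesis psi_rs : forall k (U V : opens T) (h : U `<=` W k) (i : V `<=` U)
  (l : V `<=` W k) x, psi l (mrs M i x) = map_mx (mrs N i) (psi h x).
Hypothesis psi_trans : forall k l (V : opens T) (hk : V `<=` W k) (hl : V `<=` W l),
  exists A B : 'M[O V]_r,
    [/\ inverses_mx A B,
        (forall b, mrs E hl (e l b) = lincomb (e k) hk (A ^~ b)) &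
        (forall x, psi hk x = mxact A B (psi hl x))].

Local Notation chi k h := (frame_coord (@e_frame k) h).
Local Notation dst k b := (dual_coord ev_dual (@e_frame k) b).

Definition outer (V : opens T) (c c' : 'I_r -> O V) (l : N V) : 'M[N V]_r :=
  \matrix_(a, b) ((c a * c' b) *: l).

(** The matrix in the frame [e k] of the endomorphism sending y to ev(d, y) x, with coefficient [l]:
    the chart expression of the tensor of [d], [x] and [l]. *)
Definition mx_of k (V : opens T) (h : V `<=` W k) (d : D V) (x : E V) l :=
  outer (chi k h x) (fun b => ev V d (mrs E h (e k b)) : O V) l.

(** From the frame [e l] to the frame [e k], the column of coordinates of [x] is multiplied on the
    left by [A], and the row of values of [d] on the right by [B]. *)
Lemma mx_of_trans k l (V : opens T) (hk : V `<=` W k) (hl : V `<=` W l) A B d x n :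
  A *m B = 1%:M ->
  (forall b, mrs E hl (e l b) = lincomb (e k) hk (A ^~ b)) ->
  mx_of hk d x n = mxact A B (mx_of hl d x n).
Proof.
move=> AB eA.
have ABE a b : \sum_c A a c * B c b = (a == b)%:R.
  by have := congr1 (fun Z : 'M_r => Z a b) AB; rewrite !mxE.
have chiE a : chi k hk x a = \sum_c A a c * chi l hl x c.
  rewrite -{1}[x](frame_coordK (@e_frame l) hl) /lincomb.
  under eq_bigr => c _ do rewrite eA scaler_sumr.
  rewrite exchange_big /=.
  under eq_bigr => b _ do under eq_bigr => c _ do rewrite scalerA mulrC.
  under eq_bigr => b _ do rewrite -scaler_suml.
  exact: (congr1 (@^~ a) (lincombK (@e_frame k) hk _)).
have evE b : (ev V d (mrs E hk (e k b)) : O V) =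
    \sum_c (ev V d (mrs E hl (e l c)) : O V) * B c b.
  under eq_bigr => c _ do rewrite eA bl_sumr mulr_suml.
  rewrite exchange_big /= (bigD1 b) //= [X in _ + X]big1 ?addr0.
    under eq_bigr => c _ do rewrite [X in X * _]mulrC -mulrA.
    by rewrite -mulr_sumr ABE eqxx mulr1.
  move=> a /negPf ab; under eq_bigr => c _ do rewrite [X in X * _]mulrC -mulrA.
  by rewrite -mulr_sumr ABE ab mulr0.
apply/matrixP => a b; rewrite !mxE chiE evE mulr_suml scaler_suml.
apply: eq_bigr => c _; rewrite mulr_sumr scaler_suml.
apply: eq_bigr => c' _; rewrite mxE scalerA; congr (_ *: _).
by rewrite [X in _ * X = _]mulrC mulrACA.
Qed.

Lemma mx_of_rs k (V V' : opens T) (h : V `<=` W k) (h' : V' `<=` W k)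
    (i : V' `<=` V) d x n :
  mx_of h' (mrs D i d) (mrs E i x) (mrs N i n) = map_mx (mrs N i) (mx_of h d x n).
Proof.
apply/matrixP => a b; rewrite !mxE mrs_scale rmorphM (frame_coord_rs _ h) /=.
by congr ((_ * _) *: _); rewrite -(mrs_comp h i h') bl_rs.
Qed.

Lemma psi_ext (U : opens T) (m m' : M U) :
  (forall k (V : opens T) (h : V `<=` U) (hk : V `<=` W k),
     psi hk (mrs M h m) = psi hk (mrs M h m')) -> m = m'.
Proof.
move=> mm'; apply: mod_sep => x Ux; have [k Wx] := W_cover x.
exists (ocap U (W k)), (@ocapl _ _ _); split=> //.
exact: (bij_inj (psi_bij (@ocapr _ _ _))) (mm' _ _ _ _).
Qed.

(** The predicate given to [mod_glue] prescribes the matrix in a single chart. By [psi_trans] and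
    [mx_of_trans] the prescription does not depend on the chart, which is the uniqueness that gluing
    requires. *)
Lemma twisted_trilinear_glue (U : opens T) (d : D U) (x : E U) (n : N U) :
  exists m : M U, forall k (V : opens T) (h : V `<=` U) (hk : V `<=` W k),
    psi hk (mrs M h m) = mx_of hk (mrs D h d) (mrs E h x) (mrs N h n).
Proof.
pose Q (V : opens T) (m : M V) := exists (h : V `<=` U) k (hk : V `<=` W k),
  psi hk m = mx_of hk (mrs D h d) (mrs E h x) (mrs N h n).
have [V V' i m [h [k [hk mE]]]|V m m' [h [k [hk mE]]] [h' [k' [hk' mE']]]|u Uu|m mP] :=
    mod_glue (U := U) (P := Q).
- have h' : V' `<=` U := subset_trans i h.
  have hk' : V' `<=` W k := subset_trans i hk.
  exists h', k, hk'; rewrite (psi_rs hk) mE -(mx_of_rs _ hk').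
  by rewrite !(mrs_comp _ _ h').
- apply: (bij_inj (psi_bij hk)); have [A [B [[AB BA] eA psiA]]] := psi_trans hk hk'.
  rewrite (psiA m') mE' mE (Prop_irrelevance h' h); exact: mx_of_trans.
- have [k Wu] := W_cover u; pose V := ocap U (W k).
  have h : V `<=` U by exact: ocapl.
  have hk : V `<=` W k by exact: ocapr.
  have [g _ gK] := psi_bij hk.
  by exists V, h, (g (mx_of hk (mrs D h d) (mrs E h x) (mrs N h n))); split=> //;
    exists h, k, hk; rewrite gK.
exists m => k V h hk; have [g _ gK] := psi_bij hk.
rewrite -[RHS]gK; congr (psi hk _); apply: mP; exists h, k, hk.
by rewrite gK.
Qed.

Definition twisted_map (U : opens T) (d : D U) (x : E U) (n : N U) : M U :=
  projT1 (cid (twisted_trilinear_glue d x n)).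

Lemma twisted_mapE (U : opens T) (d : D U) (x : E U) (n : N U) k
    (V : opens T) (h : V `<=` U) (hk : V `<=` W k) :
  psi hk (mrs M h (twisted_map d x n)) =
  mx_of hk (mrs D h d) (mrs E h x) (mrs N h n).
Proof. by rewrite /twisted_map; case: cid => m /= ->. Qed.

Definition twisted_trilinear : trilinear_map D E N M.
Proof.
refine (@TrilinearMap T O D E N M twisted_map _ _ _ _).
- move=> U a x x' y l; apply: psi_ext => k V h hk.
  rewrite raddfD mrs_scale raddfD psiZ !twisted_mapE; apply/matrixP => i j.
  rewrite !mxE raddfD mrs_scale bl_linl scalerA -scalerDl; congr (_ *: _).
  by rewrite mulrDr mulrCA.
- move=> U a x y y' l; apply: psi_ext => k V h hk.
  rewrite raddfD mrs_scale raddfD psiZ !twisted_mapE; apply/matrixP => i j.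
  rewrite !mxE raddfD mrs_scale frame_coord_lin scalerA -scalerDl; congr (_ *: _).
  by rewrite mulrDl mulrA.
- move=> U a x y l l'; apply: psi_ext => k V h hk.
  rewrite raddfD mrs_scale raddfD psiZ !twisted_mapE; apply/matrixP => i j.
  by rewrite !mxE raddfD mrs_scale scalerDr !scalerA mulrC.
- move=> U V h x y l; apply: psi_ext => k V' h' hk.
  have h2 : V' `<=` U := subset_trans h' h.
  by rewrite (mrs_comp _ _ h2) !twisted_mapE !(mrs_comp _ _ h2).
Defined.

Definition tensor3 : trilinear_map D E N P.
Proof.
refine (@TrilinearMap T O D E N P (fun U d x n => b2 U (b1 U d x) n) _ _ _ _).
- by move=> *; rewrite !bl_linl.
- by move=> *; rewrite bl_linr bl_linl.
- by move=> *; rewrite bl_linr.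
- by move=> *; rewrite !bl_rs.
Defined.

(* The unit matrix at (a, b) stands for the tensor of the b-th dual coordinate and e_a. *)
Definition local_inv k (V : opens T) (h : V `<=` W k) (g : 'M[N V]_r) : P V :=
  \sum_a \sum_b tensor3 V (mrs D h (dst k b)) (mrs E h (e k a)) (g a b).

Lemma local_inv_lin k (V : opens T) (h : V `<=` W k) c g g' :
  local_inv h (map_mx ( *:%R c) g + g') = c *: local_inv h g + local_inv h g'.
Proof.
rewrite scaler_sumr -big_split; apply: eq_bigr => a _ /=.
rewrite scaler_sumr -big_split; apply: eq_bigr => b _ /=.
by rewrite !mxE bl_linr.
Qed.

Lemma local_inv_rs k (V V' : opens T) (h : V `<=` W k) (h' : V' `<=` W k)
    (i : V' `<=` V) g :
  local_inv h' (map_mx (mrs N i) g) = mrs P i (local_inv h g).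
Proof.
rewrite !raddf_sum; apply: eq_bigr => a _.
rewrite !raddf_sum; apply: eq_bigr => b _ /=.
by rewrite -2!bl_rs !(mrs_comp _ _ h') mxE.
Qed.

(** The frame [e l] is [e k] times [A], so its dual frame is [B] times the dual frame of [e k].
    Expanding both factors by linearity moves [A] and [B] onto [g]. *)
Lemma local_inv_trans k l (V : opens T) (hk : V `<=` W k) (hl : V `<=` W l) A B g :
  A *m B = 1%:M ->
  (forall b, mrs E hl (e l b) = lincomb (e k) hk (A ^~ b)) ->
  local_inv hk (mxact A B g) = local_inv hl g.
Proof.
move=> AB eA.
have ABE a b : \sum_c A a c * B c b = (a == b)%:R.
  by have := congr1 (fun Z : 'M_r => Z a b) AB; rewrite !mxE.
have dstE b : mrs D hl (dst l b) = \sum_c B b c *: mrs D hk (dst k c).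
  rewrite [LHS](dual_coord_sum ev_dual (@e_frame k) hk).
  apply: eq_bigr => c _; congr (_ *: _); rewrite dual_coordE.
  have -> : mrs E hk (e k c) = lincomb (e l) hl (B ^~ c).
    rewrite /lincomb; under eq_bigr => a _ do rewrite eA scaler_sumr.
    rewrite exchange_big (bigD1 c) //= [X in _ + X]big1 ?addr0.
      under eq_bigr => a _ do rewrite scalerA mulrC.
      by rewrite -scaler_suml ABE eqxx scale1r.
    move=> a /negPf ac; under eq_bigr => i _ do rewrite scalerA mulrC.
    by rewrite -scaler_suml ABE ac scale0r.
  by rewrite lincombK.
rewrite /local_inv.
under [RHS]eq_bigr => c _ do under eq_bigr => d _ do rewrite eA dstE tl_sum12.
under [LHS]eq_bigr => a _ do under eq_bigr => b _ do rewrite mxE tl_sum3.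
(* The summands agree; the indices are ordered a, b, c, d on the left and c, d, a, b on the
   right. *)
under [LHS]eq_bigr => a _.
  under eq_bigr => b _ do under eq_bigr => c _ do rewrite tl_sum3.
  rewrite exchange_big; under eq_bigr => c _ do rewrite exchange_big. over.
rewrite /= exchange_big; apply: eq_bigr => c _.
by rewrite exchange_big.
Qed.

Lemma local_inv_mx_of k (V : opens T) (h : V `<=` W k) d x n :
  local_inv h (mx_of h d x n) = tensor3 V d x n.
Proof.
rewrite -{2}[x](frame_coordK (@e_frame k) h).
rewrite {2}(dual_coord_sum ev_dual (@e_frame k) h d) tl_sum12.
by apply: eq_bigr => a _; apply: eq_bigr => b _; rewrite mxE.
Qed.

Lemma local_inv_ext (U : opens T) (y y' : P U) :
  (forall k (V : opens T) (h : V `<=` U) (hk : V `<=` W k),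
     mrs P h y = mrs P h y') -> y = y'.
Proof.
move=> yy'; apply: mod_sep => x Ux; have [k Wx] := W_cover x.
by exists (ocap U (W k)), (@ocapl _ _ _); split=> //; exact: yy' (@ocapr _ _ _).
Qed.

Lemma untwist_glue (U : opens T) (m : M U) :
  exists y : P U, forall k (V : opens T) (h : V `<=` U) (hk : V `<=` W k),
    mrs P h y = local_inv hk (psi hk (mrs M h m)).
Proof.
pose Q (V : opens T) (y : P V) := exists (h : V `<=` U) k (hk : V `<=` W k),
  y = local_inv hk (psi hk (mrs M h m)).
have [V V' i y [h [k [hk ->]]]|V y y' [h [k [hk ->]]] [h' [k' [hk' ->]]]|u Uu|y yP] :=
    mod_glue (U := U) (P := Q).
- have h' : V' `<=` U := subset_trans i h.
  have hk' : V' `<=` W k := subset_trans i hk.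
  by exists h', k, hk'; rewrite -(local_inv_rs _ hk') -(psi_rs _ _ hk') (mrs_comp _ _ h').
- have [A [B [[AB BA] eA psiA]]] := psi_trans hk hk'.
  by rewrite psiA (Prop_irrelevance h' h); exact: local_inv_trans.
- have [k Wu] := W_cover u; pose V := ocap U (W k).
  have h : V `<=` U by exact: ocapl.
  have hk : V `<=` W k by exact: ocapr.
  by exists V, h, (local_inv hk (psi hk (mrs M h m))); split=> //; exists h, k, hk.
by exists y => k V h hk; apply: yP; exists h, k, hk.
Qed.

Definition untwist_map (U : opens T) (m : M U) : P U :=
  projT1 (cid (untwist_glue m)).

Lemma untwist_mapE (U : opens T) (m : M U) k (V : opens T) (h : V `<=` U)
    (hk : V `<=` W k) :
  mrs P h (untwist_map m) = local_inv hk (psi hk (mrs M h m)).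
Proof. by rewrite /untwist_map; case: cid. Qed.

Definition untwist : mod_hom M P.
Proof.
refine (@mod_hom_of T O M P untwist_map _ _).
- move=> U a x y; apply: local_inv_ext => k V h hk.
  rewrite raddfD mrs_scale !(untwist_mapE _ _ hk) raddfD mrs_scale raddfD psiZ.
  exact: local_inv_lin.
- move=> U V h x; apply: local_inv_ext => k V' h' hk.
  have h2 : V' `<=` U := subset_trans h' h.
  by rewrite (mrs_comp _ _ h2) !(untwist_mapE _ _ hk) (mrs_comp _ _ h2).
Defined.

(** What is known of the twist is condensed in [psi_trans]: one pair of inverse matrices changes
    both the frames of [E] and the charts of [M]. The inverse of [untwist] is the lift of
    [twisted_trilinear]. *)
Lemma twisted_iso_tensor : mod_iso M P.
Proof.
have [F FE] := triple_tensor_lift b1_tensor b2_tensor twisted_trilinear.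
exists untwist => U; exists (F U) => [m|z].
  apply: psi_ext => k V h hk; rewrite -mh_rs (untwist_mapE _ _ hk).
  set g := psi hk (mrs M h m).
  (* A tensor of dual coordinate b, frame vector a and [g a b] returns to the matrix whose only
     possibly nonzero entry is [g a b] at (a, b); the sum over a and b recovers [g]. *)
  have FE1 a b i j : psi hk (F V (tensor3 V (mrs D hk (dst k b))
      (mrs E hk (e k a)) (g a b))) i j = ((i == a)%:R * (b == j)%:R) *: g a b.
    rewrite /= FE /= -[twisted_map _ _ _](mrs_id (@subset_refl _ V)) twisted_mapE.
    rewrite mxE !mrs_id dual_coordE !frame_coord_frame.
    by [].
  rewrite /local_inv !raddf_sum; apply/matrixP => i j; rewrite summxE.
  rewrite (bigD1 i) //= [X in _ + X]big1 ?addr0 => [|a /negPf ai].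
    rewrite !raddf_sum summxE (bigD1 j) //= [X in _ + X]big1 ?addr0 => [|b /negPf bj].
      by rewrite FE1 !eqxx mul1r scale1r.
    by rewrite FE1 bj mulr0 scale0r.
  rewrite !raddf_sum summxE big1 // => b _.
  by rewrite FE1 eq_sym ai mul0r scale0r.
(* The other composite has no formula on general sections of [P], so it and the identity are
   packaged as morphisms and compared on tensors. *)
have GF_lin V a x y : untwist V (F V (a *: x + y)) =
    a *: untwist V (F V x) + untwist V (F V y) by rewrite !linearP.
have GF_rs (V V' : opens T) (h : V' `<=` V) x :
    untwist V' (F V' (mrs P h x)) = mrs P h (untwist V (F V x)) by rewrite !mh_rs.
have id_lin V a (x y : P V) : a *: x + y = a *: x + y by [].
have id_rs (V V' : opens T) (h : V' `<=` V) x : mrs P h x = mrs P h x by [].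
apply: (triple_tensor_ext b1_tensor b2_tensor (f := mod_hom_of GF_lin GF_rs)
  (g := mod_hom_of id_lin id_rs)) => {z}V d x n /=.
apply: local_inv_ext => k V' h hk.
by rewrite (untwist_mapE _ _ hk) FE twisted_mapE local_inv_mx_of /= -!bl_rs.
Qed.

End TwistedHom.

(** * The action of GL(r, O_n) *)

Section Liftings.
Context (R : realType) (T : topologicalType).

(** Since [J] is finite, the neighbourhoods on which single sections lift can be intersected. During
    the induction the values at indices not yet treated are irrelevant; they start at 0. *)
Lemma locally_surjective_family (O O' : alg_sheaf R T) (q : alg_hom O O')
    (J : finType) (U : opens T) (s : J -> O' U) x :
  locally_surjective q -> oset U x ->
  exists (V : opens T) (h : V `<=` U) (t : J -> O V),
    oset V x /\ forall j, q V (t j) = rs O' h (s j).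
Proof.
move=> q_surj Ux.
suff [V [h [t [Vx tE]]]] : exists (V : opens T) (h : V `<=` U) (t : J -> O V),
    oset V x /\ forall j, j \in enum J -> q V (t j) = rs O' h (s j).
  by exists V, h, t; split=> // j; apply: tE; rewrite mem_enum.
elim: (enum J) => [|j0 l [V [h [t [Vx tE]]]]].
  by exists U, (@subset_refl _ U), (fun _ => 0).
have [V' [h' [t' [Vx' tE']]]] := q_surj U (s j0) x Ux.
pose i : ocap V V' `<=` V := @ocapl _ _ _.
pose i' : ocap V V' `<=` V' := @ocapr _ _ _.
exists (ocap V V'), (subset_trans i h).
exists (fun j => if j == j0 then rs O i' t' else rs O i (t j)); split=> // j.
rewrite in_cons; case: eqP => [-> _|_ /= /tE] /=.
  by rewrite ah_rs tE' (rs_comp _ _ (subset_trans i h)).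
by rewrite ah_rs => ->; rewrite (rs_comp _ _ (subset_trans i h)).
Qed.

Context (O1 On OX : alg_sheaf R T) (p : alg_hom O1 On) (q : alg_hom On OX).
Context (n : nat).
Hypothesis p_surj : locally_surjective p.
Hypothesis ker_p : forall U a, ker p U a -> ker_pow (alg_comp q p) n U a.
Hypothesis ker_pow0 : forall U a, ker_pow (alg_comp q p) n.+1 U a -> a = 0.

(* ker p is the n-th power of I_X, so that I_X annihilates it. *)
Lemma ker_mul0 (U : opens T) (a b : O1 U) : p U a = 0 -> p U b = 0 -> a * b = 0.
Proof.
move=> /ker_p pa pb; apply: ker_pow0 => x /pa [V [h [k [c [d [Vx dK aE]]]]]].
exists V, h, k, c.
(* A product of n+1 sections of the ideal: index 0 carries [b], the others carry the n factors of a
   term of [a]. *)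
exists (fun j i => oapp (d j) (rs O1 h b) (unlift ord0 i)).
split=> // [j i|].
  case: unliftP => [i' _|_] /=; first exact: dK.
  by rewrite /ker /= ah_rs pb !raddf0.
rewrite rmorphM aE mulr_suml; apply: eq_bigr => j _.
rewrite big_ord_recl unlift_none -mulrA; congr (_ * _); rewrite mulrC.
by congr (_ * _); apply: eq_bigr => i _; rewrite liftK.
Qed.

(** The entries of [theta] and of its inverse [omega] are lifted together, tagged [true] and
    [false]. The lifts are inverse to each other modulo the kernel of [p], in which all products
    vanish by [ker_mul0], so their products are invertible. *)
Lemma lift_GL (r : nat) (U : opens T) (theta omega : 'M[On U]_r) x :
  inverses_mx theta omega -> oset U x ->
  exists (V : opens T) (h : V `<=` U) (lift inv : 'M[O1 V]_r),
    [/\ oset V x, inverses_mx lift inv, map_mx (p V) lift = map_mx (rs On h) theta &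
        map_mx (p V) inv = map_mx (rs On h) omega].
Proof.
move=> [tw wt] Ux.
have [V [h [t [Vx tE]]]] := locally_surjective_family
  (fun i : bool * ('I_r * 'I_r) => (if i.1 then theta else omega) i.2.1 i.2.2)
  p_surj Ux.
pose L : 'M_r := \matrix_(i, j) t (true, (i, j)).
pose S : 'M_r := \matrix_(i, j) t (false, (i, j)).
have pL : map_mx (p V) L = map_mx (rs On h) theta.
  by apply/matrixP => i j; rewrite !mxE tE.
have pS : map_mx (p V) S = map_mx (rs On h) omega.
  by apply/matrixP => i j; rewrite !mxE tE.
have sq0 (Z : 'M[O1 V]_r) : map_mx (p V) Z = 1%:M -> (1%:M - Z) *m (1%:M - Z) = 0.
  move=> pZ; apply/matrixP => i j; rewrite !mxE big1 // => k _.
  have pZ0 a b : p V ((1%:M - Z) a b) = 0.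
    have := congr1 (fun Z : 'M_r => Z a b) pZ; rewrite !mxE rmorphB => ->.
    by rewrite rmorph_nat subrr.
  exact: ker_mul0.
have pLS : map_mx (p V) (L *m S) = 1%:M.
  by rewrite map_mxM pL pS -map_mxM tw map_mx1.
have pSL : map_mx (p V) (S *m L) = 1%:M.
  by rewrite map_mxM pL pS -map_mxM wt map_mx1.
(* An inverse of Z = 1 - e with e^2 = 0 is 1 + e. *)
have inv1 (Z : 'M[O1 V]_r) : map_mx (p V) Z = 1%:M ->
    Z *m (1%:M + (1%:M - Z)) = 1%:M /\ (1%:M + (1%:M - Z)) *m Z = 1%:M.
  move=> /sq0; rewrite mulmxBl mul1mx mulmxBr mulmx1 => /eqP.
  rewrite subr_eq0 => /eqP e; split.
    by rewrite mulmxDr mulmx1 mulmxBr mulmx1 -e addrC subrK.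
  by rewrite mulmxDl mul1mx mulmxBl mul1mx -e addrC subrK.
(* One Newton correction S (2 - L S) of the approximate inverse [S] is a right inverse of [L]. The
   symmetric correction is a left inverse, hence equal to it. *)
pose I := S *m (1%:M + (1%:M - L *m S)).
have LI : L *m I = 1%:M by rewrite mulmxA (inv1 _ pLS).1.
have IL : I *m L = 1%:M.
  have JL : (1%:M + (1%:M - S *m L)) *m S *m L = 1%:M.
    by rewrite -mulmxA (inv1 _ pSL).2.
  by rewrite -[I]mul1mx -JL -(mulmxA _ L) LI mulmx1 JL.
exists V, h, L, I; split=> //.
(* The image of the inverse is omega theta p(I) = omega p(L I) = omega. *)
rewrite -[LHS]mul1mx -[in LHS](map_mx1 (rs On h)) -wt map_mxM -pL -mulmxA -map_mxM LI.
by rewrite map_mx1 mulmx1.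
Qed.

(** Conjugation by a lift fixes the summand 1, leaving L phi(g) I = phi(g'). By [ipi_scale] the
    entries of [L] and [I] act on the image of [phi] through their restrictions to X, which are
    those of [theta] and [omega], and [phi] is injective. As [acts_to] constrains [g'] through
    invertible lifts, the argument is local. *)
Lemma acts_to_mxact (r : nat) (N : mod_sheaf OX)
    (phi : ideal_pow_iso (alg_comp q p) n N) (U : opens T)
    (theta omega : 'M[On U]_r) (g g' : 'M[N U]_r) :
  inverses_mx theta omega -> acts_to p phi theta g g' ->
  g' = mxact (map_mx (q U) theta) (map_mx (q U) omega) g.
Proof.
move=> tw act; apply/matrixP => a b; apply: mod_sep => x Ux.
have [V [h [L [I [Vx LI pL pI]]]]] := lift_GL tw Ux.
exists V, h; split=> //; have := act V h L I LI pL.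
rewrite /ker_incl mulmxDr mulmxDl mulmx1 LI.1 => /addrI.
move=> /(congr1 (fun Z : 'M_r => Z a b)); rewrite !mxE => e.
apply: (ipi_inj (i := phi)); rewrite -e [X in mrs N h X]exchange_big !raddf_sum.
apply: eq_bigr => d _; rewrite !mxE mulr_suml raddf_sum raddf_sum.
apply: eq_bigr => c _; rewrite !mxE mrs_scale rmorphM -!ah_rs.
have -> : rs On h (theta a c) = p V (L a c).
  by have := congr1 (fun Z : 'M_r => Z a c) pL; rewrite !mxE.
have -> : rs On h (omega d b) = p V (I d b).
  by have := congr1 (fun Z : 'M_r => Z d b) pI; rewrite !mxE.
rewrite -rmorphM -rmorphM.
by rewrite [RHS](ipi_scale phi) mulrAC.
Qed.

End Liftings.

(** * Frames attached to a cocycle *)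

Lemma dep_choice (I : Type) (B : I -> Type) (P : forall i, B i -> Prop) :
  (forall i, exists b, P i b) -> exists f : forall i, B i, forall i, P i (f i).
Proof.
move=> ex; exists (fun i => projT1 (cid (ex i))) => i.
exact: (projT2 (cid (ex i))).
Qed.

Section FrameChange.
Context (T : topologicalType) (O : ring_sheaf T) (F : mod_sheaf O) (r : nat).

Lemma lincomb_mul (W V V' : opens T) (e : 'I_r -> F W) (h : V `<=` W)
    (h' : V' `<=` V) (l : V' `<=` W) (P : 'M[O V]_r) (c : 'I_r -> O V') :
  lincomb (fun b => lincomb e h (P ^~ b)) h' c =
  lincomb e l (fun a => \sum_b rs O h' (P a b) * c b).
Proof.
rewrite /lincomb; under eq_bigr => b _ do rewrite (mrs_lincomb e h l) scaler_sumr.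
rewrite exchange_big; apply: eq_bigr => a _; rewrite scaler_suml.
by apply: eq_bigr => b _; rewrite scalerA mulrC.
Qed.

Lemma frame_change (W V : opens T) (e : 'I_r -> F W) (h : V `<=` W)
    (P Q : 'M[O V]_r) :
  inverses_mx P Q -> frame e -> frame (fun b => lincomb e h (P ^~ b)).
Proof.
move=> [PQ QP] eF V' k; have l := subset_trans k h; have [g gK Kg] := eF V' l.
have inv (P' Q' : 'M[O V]_r) (c : 'I_r -> O V') : P' *m Q' = 1%:M ->
    (fun a => \sum_b rs O k (P' a b) * \sum_d rs O k (Q' b d) * c d) = c.
  move=> PQ'; apply/funext => a.
  under eq_bigr => b _ do rewrite mulr_sumr.
  rewrite exchange_big (bigD1 a) //= [X in _ + X]big1 ?addr0.
    under eq_bigr => b _ do rewrite mulrA -rmorphM.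
    rewrite -mulr_suml -raddf_sum /=.
    have := congr1 (fun Z : 'M_r => Z a a) PQ'; rewrite !mxE eqxx => ->.
    by rewrite rmorph1 mul1r.
  move=> d /negPf da; under eq_bigr => b _ do rewrite mulrA -rmorphM.
  rewrite -mulr_suml -raddf_sum /=.
  have := congr1 (fun Z : 'M_r => Z a d) PQ'; rewrite !mxE eq_sym da => ->.
  by rewrite rmorph0 mul0r.
exists (fun x b => \sum_a rs O k (Q b a) * g x a) => [c|x].
  rewrite (lincomb_mul _ _ _ l) gK; exact: inv.
by rewrite (lincomb_mul _ _ _ l) inv.
Qed.

(** The [W k] refine the cover of [c] through the index map [a], because cohomologous cocycles are
    compared on a refinement. Columns of the transition matrices express the frame [e l] in the
    frame [e k]. *)
Definition cocycle_frames (c : cocycle O r) (K : Type) (W : K -> opens T)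
    (a : K -> ix c) (e : forall k, 'I_r -> F (W k)) : Prop :=
  [/\ (forall x, exists k, oset (W k) x),
      (forall k, W k `<=` cov (a k)),
      (forall k, frame (e k)) &
      (forall k l (V : opens T) (hk : V `<=` W k) (hl : V `<=` W l)
          (hkl : V `<=` ocap (cov (a k)) (cov (a l))) b,
         mrs F hl (e l b) =
         lincomb (e k) hk (fun i => rs O hkl (tr (a k) (a l) i b)))].

(** The frame over U_i is the inverse image of the standard basis by psi_i. As psi_i = theta_ij
    psi_j, the trivialization i sends the b-th vector of the frame j to the b-th column of
    theta_ij. *)
Lemma transition_frames (c : cocycle O r) :
  has_transition c F ->
  exists (K : Type) (W : K -> opens T) (a : K -> ix c)
         (e : forall k, 'I_r -> F (W k)), cocycle_frames a e.
Proof.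
move=> [psi [psi_bij psi_rs psi_tr]].
have /dep_choice [e eE] : forall i, exists e : 'I_r -> F (cov i),
    forall b, psi i _ (@subset_refl _ _) (e b) = delta_mx b 0.
  move=> i; have [g _ gK] := psi_bij i _ (@subset_refl _ (cov i)).
  by exists (fun b => g (delta_mx b 0)) => b; rewrite gK.
have psi_lincomb i (V : opens T) (h : V `<=` cov i) c0 :
    psi i V h (lincomb (e i) h c0) = \col_a c0 a.
  rewrite linear_sum; apply/colP => a; rewrite summxE (bigD1 a) //= [X in _ + X]big1.
    rewrite linearZ (psi_rs _ _ _ (@subset_refl _ _)) eE !mxE !eqxx.
    by rewrite rmorph1 mulr1 addr0.
  move=> b /negPf ba.
  rewrite linearZ (psi_rs _ _ _ (@subset_refl _ _)) eE !mxE eq_sym ba.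
  by rewrite rmorph0 mulr0.
exists (ix c), (@cov _ _ _ c), id, e; split; [exact: cov_total|by move=> i| |].
  move=> i V h; have [g gK Kg] := psi_bij i V h.
  exists (fun x a => psi i V h x a 0) => [c0|x].
    by apply/funext => a; rewrite psi_lincomb mxE.
  apply: (can_inj gK); rewrite psi_lincomb; apply/colP => a; by rewrite mxE.
move=> k l V hk hl hkl b; apply: (bij_inj (psi_bij k V hk)).
rewrite psi_lincomb (psi_tr _ _ _ hk hl hkl) (psi_rs _ _ _ (@subset_refl _ _)) eE.
apply/colP => i; rewrite !mxE (bigD1 b) //= big1 ?addr0 => [|j /negPf jb].
  by rewrite !mxE !eqxx rmorph1 mulr1.
by rewrite !mxE jb rmorph0 mulr0.
Qed.

(** Multiplication of frames by the inverses of the [h k] should turn one cocycle into the other.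
    However, on an intersection of some [W k] and [W1 k1] the frame has index [a k] in [c] and the
    cohomology has index [a1 k1]; the frame is first moved from one index to the other by a
    transition matrix of [c]. *)
Lemma cohomologous_frames (c c' : cocycle O r) (K : Type) (W : K -> opens T)
    (a : K -> ix c) (e : forall k, 'I_r -> F (W k)) :
  cohomologous c c' -> cocycle_frames a e ->
  exists (K' : Type) (W' : K' -> opens T) (a' : K' -> ix c')
         (e' : forall k, 'I_r -> F (W' k)), cocycle_frames a' e'.
Proof.
move=> [K1 [W1 [a1 [b1 [h [W1cov [W1a W1b] hGL hE]]]]]] [Wcov Wa eF eE].
have /dep_choice [hV hVE] := hGL.
pose K' := (K * K1)%type; pose W' (k : K') := ocap (W k.1) (W1 k.2).
have W'l (k : K') : W' k `<=` W k.1 := @ocapl _ _ _.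
have W'r (k : K') : W' k `<=` W1 k.2 := @ocapr _ _ _.
have W'c (k : K') : W' k `<=` ocap (cov (a k.1)) (cov (a1 k.2)).
  by apply: sub_ocap; [exact: subset_trans (Wa _)|exact: subset_trans (W1a _)].
pose P (k : K') : 'M[O (W' k)]_r :=
  map_mx (rs O (W'c k)) (tr (a k.1) (a1 k.2)) *m map_mx (rs O (W'r k)) (hV k.2).
exists K', W', (fun k => b1 k.2), (fun k b => lincomb (e k.1) (W'l k) (P k ^~ b)).
split=> [x|k|k|k l V hk hl hkl b].
- have [k Wk] := Wcov x; have [k1 Wk1] := W1cov x.
  by exists (k, k1).
- exact: subset_trans (W1b _).
- have [t [Pt tP]] := tr_GL (a k.1) (a1 k.2); have [hh hh'] := hVE k.2.
  apply: (@frame_change _ _ _ _ _ (map_mx (rs O (W'r k)) (h k.2) *m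
    map_mx (rs O (W'c k)) t)) => //; split.
    by rewrite mulmxA -(mulmxA _ _ (map_mx _ (h _))) -map_mxM hh' map_mx1 mulmx1
      -map_mxM Pt map_mx1.
  by rewrite mulmxA -(mulmxA _ (map_mx _ t)) -map_mxM tP map_mx1 mulmx1 -map_mxM
    hh map_mx1.
have [hk1 hl1] := (subset_trans hk (W'l k), subset_trans hl (W'l l)).
have [hkr hlr] := (subset_trans hk (W'r k), subset_trans hl (W'r l)).
have [hka hla] := (subset_trans hk1 (Wa _), subset_trans hl1 (Wa _)).
have [hka1 hla1] := (subset_trans hkr (W1a _), subset_trans hlr (W1a _)).
have haa := sub_ocap hka hla.
have hka' := sub_ocap hka hka1; have hla' := sub_ocap hla hla1.
have hkl' := sub_ocap hka hla1; have hkl1 := sub_ocap hka1 hla1.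
rewrite (lincomb_mul _ _ _ hk1) (mrs_lincomb _ _ hl1).
have -> : lincomb (e l.1) hl1 (fun i => rs O hl (P l i b)) =
    lincomb (e k.1) hk1 (fun i => \sum_j rs O haa (tr (a k.1) (a l.1) i j) *
      rs O hl (P l j b)).
  rewrite /lincomb; under eq_bigr => j _ do rewrite (eE _ _ _ hk1 _ haa) scaler_sumr.
  rewrite exchange_big; apply: eq_bigr => i _; rewrite scaler_suml.
  by apply: eq_bigr => j _; rewrite scalerA mulrC.
congr lincomb; apply/funext => i.
have rsP (l0 : K') (hl0 : V `<=` W' l0) (hc : V `<=` ocap (cov (a l0.1)) (cov (a1 l0.2)))
    (hr : V `<=` W1 l0.2) : map_mx (rs O hl0) (P l0) =
    map_mx (rs O hc) (tr (a l0.1) (a1 l0.2)) *m map_mx (rs O hr) (hV l0.2).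
  rewrite map_mxM; congr (_ *m _); apply/matrixP => ? ?; rewrite !mxE;
  exact: rs_comp.
(* By the cocycle relation and [hE], both sides equal [tr (a k.1) (a1 l.2)] times [hV l.2],
   restricted to [V]. *)
suff : map_mx (rs O haa) (tr (a k.1) (a l.1)) *m
    map_mx (rs O hl) (P l) = map_mx (rs O hk) (P k) *m
    map_mx (rs O hkl) (tr (b1 k.2) (b1 l.2)).
  move: (P l) (P k) => Pl Pk /(congr1 (fun Z : 'M_r => Z i b)); rewrite !mxE.
  under eq_bigr do rewrite !mxE; under [in RHS]eq_bigr do rewrite !mxE.
  exact.
rewrite (rsP _ _ hla' hlr) (rsP _ _ hka' hkr) mulmxA (tr_cocycle haa hla' hkl').
have Z0 := hE _ _ V hkr hlr hkl1 hkl.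
have hlhV : map_mx (rs O hlr) (h l.2) *m map_mx (rs O hlr) (hV l.2) = 1%:M.
  by rewrite -map_mxM (hVE l.2).1 map_mx1.
have hVkh : map_mx (rs O hkr) (hV k.2) *m map_mx (rs O hkr) (h k.2) = 1%:M.
  by rewrite -map_mxM (hVE k.2).2 map_mx1.
have -> : map_mx (rs O hkl) (tr (b1 k.2) (b1 l.2)) =
    map_mx (rs O hkr) (h k.2) *m map_mx (rs O hkl1) (tr (a1 k.2) (a1 l.2)) *m
    map_mx (rs O hlr) (hV l.2) by rewrite -Z0 -mulmxA hlhV mulmx1.
rewrite -!mulmxA (mulmxA (map_mx _ (hV k.2))) hVkh mul1mx mulmxA.
by rewrite (tr_cocycle hka' hkl1 hkl').
Qed.

Lemma cohomologous_sym (c c' : cocycle O r) :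
  cohomologous c c' -> cohomologous c' c.
Proof.
move=> [K [W [a [b [h [Wcov [Wa Wb] hGL hE]]]]]].
have /dep_choice [hV hVE] := hGL.
exists K, W, b, a, hV; split=> //.
  by move=> k; exists (h k); case: (hVE k).
move=> k l V Vk Vl Vb Va.
have hlhV : map_mx (rs O Vl) (h l) *m map_mx (rs O Vl) (hV l) = 1%:M.
  by rewrite -map_mxM (hVE l).1 map_mx1.
have hVkh : map_mx (rs O Vk) (hV k) *m map_mx (rs O Vk) (h k) = 1%:M.
  by rewrite -map_mxM (hVE k).2 map_mx1.
have -> : map_mx (rs O Vb) (tr (b k) (b l)) = map_mx (rs O Vk) (h k) *m
    map_mx (rs O Va) (tr (a k) (a l)) *m map_mx (rs O Vl) (hV l).
  by rewrite -(hE _ _ _ Vk Vl Va Vb) -mulmxA hlhV mulmx1.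
by rewrite !mulmxA hVkh mul1mx.
Qed.

End FrameChange.

(** * Restriction of frames to a closed subscheme *)

Section FrameRestriction.
Context (R : realType) (T : topologicalType) (O O' : alg_sheaf R T).
Context (q : alg_hom O O') (F : mod_sheaf O) (F' : mod_sheaf O') (r : nat).
Hypothesis q_surj : locally_surjective q.
Context (rho : forall U : opens T, {additive F U -> F' U}).
Hypothesis rhoZ : forall U a x, rho U (a *: x) = q U a *: rho U x.
Hypothesis rho_rs : forall (U V : opens T) (h : V `<=` U) x,
  rho V (mrs F h x) = mrs F' h (rho U x).
Hypothesis rho_surj : forall (U : opens T) (y : F' U) t, oset U t ->
  exists (V : opens T) (h : V `<=` U) (x : F V),
    oset V t /\ rho V x = mrs F' h y.
Hypothesis rho_ker : forall U x, rho U x = 0 -> forall t, oset U t ->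
  exists (V : opens T) (h : V `<=` U) (k : nat) (a : 'I_k -> O V)
         (y : 'I_k -> F V),
    [/\ oset V t, (forall j, ker q V (a j)) & mrs F h x = \sum_(j < k) a j *: y j].

Lemma rho_lincomb (W V : opens T) (e : 'I_r -> F W) (h : V `<=` W) c :
  rho V (lincomb e h c) =
  lincomb (fun b => rho W (e b)) h (fun a => q V (c a)).
Proof. by rewrite raddf_sum; apply: eq_bigr => a _; rewrite rhoZ rho_rs. Qed.

(** A relation with coefficients c lifts locally to a combination of the [e b], with coefficients t,
    killed by [rho], hence to a sum of the [a j *: y j] with [a j] in [ker q]. Taking coordinates in
    the frame shows that t is in [ker q], so c = q(t) vanishes. *)
Lemma lincomb_rho_inj (W V : opens T) (e : 'I_r -> F W) (h : V `<=` W) :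
  frame e -> injective (lincomb (fun b => rho W (e b)) h).
Proof.
move=> eF; set f := lincomb _ h.
have f0 c : f c = 0 -> c = fun _ => 0.
  move=> fc; apply/funext => a; apply: ring_sep => x Vx.
  have [V1 [h1 [t [Vx1 tE]]]] := locally_surjective_family c q_surj Vx.
  have k1 := subset_trans h1 h.
  have : rho V1 (lincomb e k1 t) = 0.
    rewrite rho_lincomb; transitivity (mrs F' h1 (f c)); last by rewrite fc raddf0.
    rewrite (mrs_lincomb _ h k1); congr lincomb; apply/funext => b; exact: tE.
  move=> /rho_ker /(_ x Vx1) [V2 [h2 [m [al [y [Vx2 alK]]]]]].
  have k2 := subset_trans h2 k1.
  rewrite (mrs_lincomb _ k1 k2).
  move=> /(congr1 (fun z => q V2 (frame_coord eF k2 z a))).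
  rewrite lincombK (lin_lincomb (W := (O V2)^o) (f := fun z => frame_coord eF k2 z a));
    last by move=> *; exact: frame_coord_lin.
  rewrite rmorph_sum big1 => [e0|j _]; last by rewrite rmorphM alK mul0r.
  have h12 := subset_trans h2 h1.
  exists V2, h12; split=> //.
  by rewrite rmorph0 -(rs_comp h1 h2) -tE -ah_rs e0.
move=> c c' fcc'; have /f0 c0 : f (fun a => c a - c' a) = 0.
  rewrite -(subrr (f c)) {2}fcc' -sumrB.
  by apply: eq_bigr => a _; rewrite scalerBl.
by apply/funext => a; apply/subr0_eq/(congr1 (@^~ a) c0).
Qed.

(** For surjectivity, [y] is lifted locally to [F] and the coordinates of the lift are sent to [O']
    by [q]. Injectivity makes these local coefficients unique, so they glue. *)
Lemma frame_restriction (W : opens T) (e : 'I_r -> F W) :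
  frame e -> frame (fun b => rho W (e b)).
Proof.
move=> eF V h; set f := lincomb _ h.
suff /choice [g gP] : forall y, exists c, f c = y.
  by exists g => // c; apply: (lincomb_rho_inj (h := h) eF); exact: gP.
move=> y.
pose Q (V' : opens T) (c : 'I_r -> O' V') := exists (i : V' `<=` V),
  lincomb (fun b => rho W (e b)) (subset_trans i h) c = mrs F' i y.
have Q_rs (V1 V2 : opens T) (i : V2 `<=` V1) c :
    Q V1 c -> Q V2 (fun a => rs O' i (c a)).
  move=> [j cE]; have k := subset_trans i j; exists k.
  by rewrite -(mrs_comp j i) -cE (mrs_lincomb _ _ (subset_trans k h)).
have Q_uniq (V1 : opens T) c c' : Q V1 c -> Q V1 c' -> c = c'.
  move=> [j cE] [j' c'E]; apply: (lincomb_rho_inj (h := subset_trans j h) eF).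
  by rewrite cE (Prop_irrelevance j j') -c'E; congr lincomb; exact: Prop_irrelevance.
have Q_ex x : oset V x -> exists (V1 : opens T) (i : V1 `<=` V) c,
    oset V1 x /\ Q V1 c.
  move=> Vx; have [V1 [i [z [Vx1 zE]]]] := rho_surj y Vx.
  exists V1, i, (fun a => q V1 (frame_coord eF (subset_trans i h) z a)); split=> //.
  by exists i; rewrite -rho_lincomb frame_coordK.
(* Each coordinate is glued separately, in [O'] seen as a module over itself. *)
have /choice [c cP] a : exists s : O' V, forall (V1 : opens T) (i : V1 `<=` V) c,
    Q V1 c -> rs O' i s = c a.
  have [V1 V2 i s [c [Qc ->]]|V1 s s' [c [Qc ->]] [c' [Qc' ->]]|x Vx|s sP] :=
      mod_glue (M := struct_mod O') (U := V)
        (P := fun V1 s => exists c, Q V1 c /\ s = c a).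
  - by exists (fun a => rs O' i (c a)); split=> //; exact: Q_rs.
  - by rewrite (Q_uniq _ _ _ Qc Qc').
  - have [V1 [i [c [Vx1 Qc]]]] := Q_ex x Vx.
    by exists V1, i, (c a); split=> //; exists c.
  by exists s => V1 i c Qc; apply: sP; exists c.
exists c; apply: mod_sep => x Vx; have [V1 [i [c1 [Vx1 Qc1]]]] := Q_ex x Vx.
exists V1, i; split=> //; have [j jE] := Qc1.
rewrite (Prop_irrelevance i j) -jE (mrs_lincomb _ _ (subset_trans j h)).
congr lincomb.
by apply/funext => a; exact: cP.
Qed.

End FrameRestriction.

Theorem proposition7p1p1
  (R : realType) (T : topologicalType) (d n r : nat)
  (n_ge1 : (1 <= n)%N) (r_ge1 : (1 <= r)%N)
  (* X = (T, OX), X_n = (T, On), X_(n+1) = (T, On1) *)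
  (OX On On1 : alg_sheaf R T) (q : alg_hom On OX) (p : alg_hom On1 On)
  (X_smooth : smooth_variety d (CSpace OX))
  (X_projective : projective (CSpace OX))
  (Xn_primitive : primitive_multiple_scheme d q n)
  (Xn1_primitive : primitive_multiple_scheme d (alg_comp q p) n.+1)
  (Xn_canonical : canonical_subscheme (alg_comp q p) p n)
  (L Ln : mod_sheaf OX)
  (L_conormal : is_conormal (alg_comp q p) L)
  (Ln_power : tensor_power L n Ln)
  (phi : ideal_pow_iso (alg_comp q p) n Ln)
  (g : H1_GL On r) (EE : mod_sheaf On) (EE_g : corresponding_bundle g EE)
  (E : mod_sheaf OX) (E_restr : is_restriction q EE E)
  (theta : cocycle On r) (theta_g : represents g theta)
  (M : mod_sheaf OX) (M_twist : is_twisted_sheaf p phi theta M)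
  (Edual EdualE EdualELn : mod_sheaf OX)
  (Edual_dual : is_dual E Edual)
  (tensor1 : tensor_product Edual E EdualE)
  (tensor2 : tensor_product EdualE Ln EdualELn) :
  mod_iso M EdualELn.
Proof.
have p_surj : locally_surjective p by case: Xn_canonical.
have q_surj : locally_surjective q by case: Xn_primitive => _ _ [].
have ker_p U a : ker p U a -> ker_pow (alg_comp q p) n U a.
  by case: Xn_canonical => _ /(_ U a) [].
have ker_pow0 : forall U a, ker_pow (alg_comp q p) n.+1 U a -> a = 0.
  by case: Xn1_primitive => _ _ _ _ [].
have [c gc EE_c] := EE_g.
have [c0 gE] := represents_class g.
have [K0 [W0 [a0 [e0 fr0]]]] := transition_frames EE_c.
(* The cocycle [c] of the bundle and the cocycle [theta] may differ, but [c0] is cohomologous to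
   both: the frames travel from [c] to [c0], against the given direction, and then to [theta]. *)
have c_c0 := cohomologous_sym ((gE c).1 gc).
have [K1 [W1 [a1 [e1 fr1]]]] := cohomologous_frames c_c0 fr0.
have c0_theta := (gE theta).1 theta_g.
have [K [W [a [e [Wcov Wa eF eE]]]]] := cohomologous_frames c0_theta fr1.
have [rho [rhoZ rho_rs rho_surj rho_ker]] := E_restr.
have [psi [psiZ psi_bij psi_rs psi_acts]] := M_twist.
have [ev ev_dual] := Edual_dual.
have [b1 b1_tensor] := tensor1.
have [b2 b2_tensor] := tensor2.
have fr k : frame (fun b => rho (W k) (e k b)).
  apply: (frame_restriction q_surj rhoZ rho_rs rho_surj _ (eF k)) => U x.
  by case: (rho_ker U x).
apply: (twisted_iso_tensor ev_dual b1_tensor b2_tensor Wcov fr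
  (psi := fun k V h => psi (a k) V (subset_trans h (Wa k)))).
- by move=> k V h x y; exact: psiZ.
- by move=> k V h; exact: psi_bij.
- by move=> k U V h i l x; exact: psi_rs.
move=> k l V hk hl.
have hkl := sub_ocap (subset_trans hk (Wa k)) (subset_trans hl (Wa l)).
have [om [tom omt]] := tr_GL (a k) (a l).
(* The matrices required by [psi_trans] are the restriction to X of a transition matrix of [theta]
   and its inverse: they change the frames by [eE] and the charts of [M] by [acts_to_mxact]. *)
exists (map_mx (q V) (map_mx (rs On hkl) (tr (a k) (a l)))).
exists (map_mx (q V) (map_mx (rs On hkl) om)).
split.
- by split; rewrite -!map_mxM ?tom ?omt !map_mx1.
- move=> b; rewrite -rho_rs (eE _ _ _ hk hl hkl) (rho_lincomb rhoZ rho_rs).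
  by congr lincomb; apply/funext => i; rewrite !mxE.
move=> x; apply: (acts_to_mxact p_surj ker_p ker_pow0 _ (psi_acts _ _ _ _ _ hkl _)).
by split; rewrite -map_mxM ?tom ?omt map_mx1.
Qed.
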